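(* Let $R>0$, $C_1\in\mathbb{R}$, $\mu=R^2C_1$, $\lambda=R^2C_2$, and let $\Lambda^\Theta$ and $D=D(R,C_1)$ be as defined in the context (with $\lambda>D$). Then: (1) For $C_1=0$, $\lim_{\lambda\to D}\Lambda^\Theta=\sqrt2\,\pi$. (2) For all $R$, $\lim_{\lambda\to D}\Lambda^\Theta$ is monotonically increasing with respect to $C_1$, and $$\lim_{C_1\to-\infty}\lim_{\lambda\to D}\Lambda^\Theta=\pi,\qquad\lim_{C_1\to+\infty}\lim_{\lambda\to D}\Lambda^\Theta=2\pi .$$ (3) For fixed $C_1$ and $R$, $\Lambda^\Theta$ is monotonically decreasing with respect to $C_2$, and $\pi<\Lambda^\Theta<\lim_{\lambda\to D}\Lambda^\Theta$. (4) For all $R,C_1,C_2$, $\pi<\Lambda^\Theta<2\pi$.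
   Context: For $\lambda>D$ the polynomial $\frac{B^3}{R^2}-C_1B^2-C_2B+4$ has two distinct positive roots $A_1>A_2$, and the progression angle is $$\Lambda^\Theta=2\sqrt{\frac{4C_2}{R^2}+C_1^2}\int_{A_2}^{A_1}\frac{B^{-1/2}\,dB}{(C_2-B^2/R^2+C_1B)\sqrt{C_2-B^2/R^2-4B^{-1}+C_1B}} .$$ The lower bound $D=D(R,C_1)$ of $\lambda$ is: if $\mu\ge-3(2R)^{2/3}$, $$D=\frac{-\mu^2-(Y_1^{1/3}+Y_2^{1/3})}{12},\quad Y_{1,2}=\mu^6+2160R^2\mu^3-93312R^4\pm48\sqrt3R\sqrt{(\mu^3+108R^2)^3}$$ (real cube roots); if $\mu\le-3(2R)^{2/3}$, $$D=\frac{-\mu^2}{12}+\frac{\sqrt{\mu(\mu^3-864R^2)}}6\cos\frac{\vartheta-\pi}3,\quad\vartheta=\arccos\frac{-\mu^6-2160R^2\mu^3+93312R^4}{\mu(864R^2-\mu^3)\sqrt{\mu(\mu^3-864R^2)}} .$$ Limits $\lambda\to D$ are taken from above. *)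

(* Defs.v *)
(* Concrete reals of the standard library, with Coquelicot for limits and
   improper Riemann integrals.  The radius is written r, since R is the type
   of real numbers. *)
From Stdlib Require Export Reals Lra Psatz.
From Coquelicot Require Export Coquelicot.
Open Scope R_scope.

(* Real cube root, defined on all of R; sign 0 = 0, so the value of Rpower
   at base 0 is irrelevant. *)
Definition cbrt (x : R) : R := sign x * Rpower (Rabs x) (1 / 3).

Lemma cbrt_pow3 (x : R) : cbrt x ^ 3 = x.
Proof.
assert (H : forall y, 0 < y -> Rpower y (1 / 3) ^ 3 = y).
{ intros y hy. rewrite <- Rpower_pow by apply exp_pos.
  rewrite Rpower_mult. replace (1 / 3 * INR 3) with 1 by (simpl; field).
  now apply Rpower_1. }
unfold cbrt. destruct (total_order_T x 0) as [[hx|hx]|hx].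
- rewrite sign_eq_m1, Rabs_left, Rpow_mult_distr, H by lra. ring.
- subst x. rewrite sign_0. ring.
- rewrite sign_eq_1, Rabs_right, Rpow_mult_distr, H by lra. ring.
Qed.

Definition cubic (r C1 C2 B : R) : R :=
  B ^ 3 / r ^ 2 - C1 * B ^ 2 - C2 * B + 4.

(* A_1 and A_2 are the largest and the smallest positive root of the cubic;
   root_A1_A2 below shows that they are the only two positive roots whenever
   the cubic has two distinct ones. *)
Definition root_A1 (r C1 C2 : R) : R :=
  real (Lub_Rbar (fun B => 0 < B /\ cubic r C1 C2 B = 0)).

Definition root_A2 (r C1 C2 : R) : R :=
  real (Glb_Rbar (fun B => 0 < B /\ cubic r C1 C2 B = 0)).

Lemma root_A1_A2 (r C1 C2 a1 a2 : R) :
  0 < r -> 0 < a2 < a1 -> cubic r C1 C2 a1 = 0 -> cubic r C1 C2 a2 = 0 ->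
  root_A1 r C1 C2 = a1 /\ root_A2 r C1 C2 = a2.
Proof.
intros hr [h2 h21] e1 e2.
assert (only : forall B, 0 < B -> cubic r C1 C2 B = 0 -> B = a1 \/ B = a2).
{ intros B hB e. unfold cubic, Rdiv in *.
  assert (hk : 0 < / r ^ 2) by (apply Rinv_0_lt_compat; nra).
  set (k := / r ^ 2) in *.
  destruct (Req_dec B a1) as [|n1]; [now left|].
  destruct (Req_dec B a2) as [|n2]; [now right|]. exfalso.
  assert (q12 : k * (a1 ^ 2 + a1 * a2 + a2 ^ 2) - C1 * (a1 + a2) - C2 = 0).
  { apply Rmult_eq_reg_l with (a1 - a2); [|lra]. lra. }
  assert (q1B : k * (a1 ^ 2 + a1 * B + B ^ 2) - C1 * (a1 + B) - C2 = 0).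
  { apply Rmult_eq_reg_l with (a1 - B); [|lra]. lra. }
  assert (s : k * (a1 + a2 + B) - C1 = 0).
  { apply Rmult_eq_reg_l with (a2 - B); [|lra]. lra. }
  assert (p : k * (a1 * a2 * B) = - 4).
  { replace C1 with (k * (a1 + a2 + B)) in * by lra.
    replace C2 with (- k * (a1 * a2 + a1 * B + a2 * B)) in * by lra. lra. }
  assert (0 < k * (a1 * a2 * B)) by (repeat apply Rmult_lt_0_compat; lra).
  lra. }
unfold root_A1, root_A2. split.
- rewrite (is_lub_Rbar_unique _ (Finite a1)); [reflexivity|]. split.
  + intros B [hB eB]. destruct (only B hB eB); subst; simpl; lra.
  + intros b hb. apply hb. split; [lra|assumption].
- rewrite (is_glb_Rbar_unique _ (Finite a2)); [reflexivity|]. split.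
  + intros B [hB eB]. destruct (only B hB eB); subst; simpl; lra.
  + intros b hb. apply hb. split; [lra|assumption].
Qed.

Definition angle_integrand (r C1 C2 B : R) : R :=
  Rpower B (- 1 / 2) /
  ((C2 - B ^ 2 / r ^ 2 + C1 * B) *
   sqrt (C2 - B ^ 2 / r ^ 2 - 4 / B + C1 * B)).

(* The integrand is singular at both A_2 and A_1: the integral is improper at
   both ends. *)
Definition progression_angle (r C1 C2 : R) : R :=
  2 * sqrt (4 * C2 / r ^ 2 + C1 ^ 2) *
  RInt_gen (angle_integrand r C1 C2)
    (at_right (root_A2 r C1 C2)) (at_left (root_A1 r C1 C2)).

Definition D_above (r mu : R) : R :=
  let P := mu ^ 6 + 2160 * r ^ 2 * mu ^ 3 - 93312 * r ^ 4 in
  let S := 48 * sqrt 3 * r * sqrt ((mu ^ 3 + 108 * r ^ 2) ^ 3) in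
  (- mu ^ 2 - (cbrt (P + S) + cbrt (P - S))) / 12.

Definition D_below (r mu : R) : R :=
  let theta :=
    acos ((- mu ^ 6 - 2160 * r ^ 2 * mu ^ 3 + 93312 * r ^ 4) /
          (mu * (864 * r ^ 2 - mu ^ 3) *
           sqrt (mu * (mu ^ 3 - 864 * r ^ 2)))) in
  - mu ^ 2 / 12 +
  sqrt (mu * (mu ^ 3 - 864 * r ^ 2)) / 6 * cos ((theta - PI) / 3).

(* The two expressions agree at the threshold value of mu = r^2 C1. *)
Definition D_bound (r C1 : R) : R :=
  let mu := r ^ 2 * C1 in
  if Rle_dec (- 3 * Rpower (2 * r) (2 / 3)) mu
  then D_above r mu else D_below r mu.

(* Main.v *)
(* Let -a be the negative root of the cubic. For fixed C1 the number a is an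
   increasing function of C2, and the two positive roots are the endpoints of
   the interval |B - (c + a/2)| <= h, where c = r^2 C1 / 2 and
   h^2 = (c + a/2)^2 - 4 r^2 / a. The substitution
   B = c + a/2 - h cos t turns the angle into 4 r times a proper integral over
   [0, pi].

   Monotonicity: the angle is a complete elliptic integral of the third kind
   with constant residues, so its derivative in a is of the second kind. Up to
   an exact derivative in t, the derivative in a of the integrand equals an
   explicit function, which turns out to be pointwise negative.

   When the two positive roots merge the integrand becomes constant, which
   gives the limit as lambda tends to D. As a tends to infinity the angle
   concentrates near A_1, where the integrand is bounded below by the derivative
   of an arctangent of total variation tending to pi; together with
   monotonicity this gives the lower bound pi. *)
Require Import Defs.
From Stdlib Require Import Reals Lra Psatz.
From Coquelicot Require Import Coquelicot.
Open Scope R_scope.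

(** * The integrand in the angular variable *)

(* Throughout m stands for 4 r^2 and a for minus the negative root of the
   cubic. The hypothesis [adm] says that the other two roots c + a/2 +- h,
   with h = [hw], are real, distinct and positive. In terms of the paper,
   [esq] = r^4 (4 C2 / r^2 + C1^2) / 4, [zed] = B - c, [bed] = B + a and
   [den] = r^2 (C2 - B^2 / r^2 + C1 B). *)
Definition adm (c m a : R) : Prop := 0 < a /\ 0 < c + a / 2 /\ m < a * (c + a / 2) ^ 2.
Definition tmid (c a : R) : R := c + 3 * a / 2.
Definition hsq (c m a : R) : R := (c + a / 2) ^ 2 - m / a.
Definition esq (c m a : R) : R := (c + a) ^ 2 - m / a.
Definition hw (c m a : R) : R := sqrt (hsq c m a).
Definition psq (c m a : R) : R := tmid c a ^ 2 - hw c m a ^ 2.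
Definition zed (c m a t : R) : R := a / 2 - hw c m a * cos t.
Definition bed (c m a t : R) : R := tmid c a - hw c m a * cos t.
Definition den (c m a t : R) : R := esq c m a - zed c m a t ^ 2.
Definition fint (c m a t : R) : R := sqrt (esq c m a) / (den c m a t * sqrt (bed c m a t)).

Lemma hsq_pos c m a : adm c m a -> 0 < hsq c m a.
Proof.
intros (ha & hc & h). unfold hsq.
assert (m / a < (c + a / 2) ^ 2); [|lra].
apply Rmult_lt_reg_l with a; auto. replace (a * (m / a)) with m by (field; lra). lra.
Qed.

Lemma hw_pos c m a : adm c m a -> 0 < hw c m a.
Proof. intros h. apply sqrt_lt_R0. now apply hsq_pos. Qed.

Lemma hw_sq c m a : adm c m a -> hw c m a ^ 2 = hsq c m a.
Proof. intros h. apply pow2_sqrt. apply Rlt_le. now apply hsq_pos. Qed.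

Lemma hw_lt c m a : 0 < m -> adm c m a -> hw c m a < c + a / 2.
Proof.
intros hm h. assert (h1 := hw_pos _ _ _ h). assert (h2 := hw_sq _ _ _ h).
destruct h as (ha & hc & h). unfold hsq in h2.
assert (0 < m / a) by (apply Rdiv_lt_0_compat; lra). nra.
Qed.

(** Trading m for h = [hw] makes the later identities polynomial in a, h and T = [tmid]. Positivity
    then comes from T - a = c + a / 2 > 0. *)
Lemma esq_hw c m a : adm c m a ->
  esq c m a = hw c m a ^ 2 + a * tmid c a - 3 / 4 * a ^ 2.
Proof. intros h. rewrite hw_sq by auto. unfold esq, hsq, tmid. lra. Qed.

Lemma esq_pos c m a : 0 < m -> adm c m a -> 0 < esq c m a.
Proof.
intros hm h. rewrite esq_hw by auto. assert (h1 := hw_pos _ _ _ h).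
destruct h as (ha & hc & h). unfold tmid. nra.
Qed.

Lemma bed_bounds c m a t : adm c m a ->
  tmid c a - hw c m a <= bed c m a t <= tmid c a + hw c m a.
Proof.
intros h. assert (h1 := hw_pos _ _ _ h). assert (h2 := COS_bound t). unfold bed. nra.
Qed.

Lemma bed_pos c m a t : 0 < m -> adm c m a -> 0 < bed c m a t.
Proof.
intros hm h. assert (h1 := bed_bounds c m a t h). assert (h2 := hw_lt _ _ _ hm h).
destruct h as (ha & hc & h). unfold tmid in h1. lra.
Qed.

(** In this form positivity is visible: T - a = c + a / 2 exceeds h by [hw_lt], so the bracket is
    positive for every value of cos t. *)
Lemma den_eq c m a t : adm c m a ->
  den c m a t = hw c m a ^ 2 * sin t ^ 2 + a * (tmid c a - a + hw c m a * cos t).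
Proof.
intros h. unfold den. rewrite esq_hw by auto. unfold zed.
assert (e := sin2_cos2 t). unfold Rsqr in e.
replace (sin t ^ 2) with (1 - cos t ^ 2) by lra. field.
Qed.

Lemma den_bounds c m a t : adm c m a ->
  a * (tmid c a - a - hw c m a) <= den c m a t
  <= hw c m a ^ 2 + a * (tmid c a - a + hw c m a).
Proof.
intros h. rewrite den_eq by auto. assert (h1 := hw_pos _ _ _ h).
assert (h2 := COS_bound t). assert (h3 := SIN_bound t).
destruct h as (ha & _).
assert (0 <= sin t ^ 2 <= 1) by (split; nra).
assert (- hw c m a <= hw c m a * cos t <= hw c m a) by (split; nra).
split; nra.
Qed.

Lemma den_pos c m a t : 0 < m -> adm c m a -> 0 < den c m a t.
Proof.
intros hm h. assert (h1 := den_bounds c m a t h). assert (h2 := hw_lt _ _ _ hm h).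
destruct h as (ha & hc & h). unfold tmid in h1. nra.
Qed.

(** [psq] = (T - h)(T + h) is the product of the extreme values of [bed]. It is also a times the
    derivative of [esq], which is why both derivatives below are expressed through it. *)
Lemma psq_eq c m a : adm c m a -> psq c m a = 2 * a * c + 2 * a ^ 2 + m / a.
Proof. intros h. unfold psq. rewrite hw_sq by auto. unfold tmid, hsq. lra. Qed.

Lemma psq_pos c m a : 0 < m -> adm c m a -> 0 < psq c m a.
Proof.
intros hm h. rewrite psq_eq by auto. destruct h as (ha & hc & h).
assert (0 < m / a) by (apply Rdiv_lt_0_compat; lra). nra.
Qed.

Lemma is_derive_hw c m a : adm c m a ->
  is_derive (hw c m) a ((psq c m a - a * tmid c a) / (2 * a * hw c m a)).
Proof.
intros h. assert (h0 := hsq_pos _ _ _ h). assert (h1 := hw_pos _ _ _ h).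
rewrite psq_eq by auto. unfold hw, hsq, tmid in *. assert (ha := proj1 h).
auto_derive; [split; [lra|split; auto]; fail|].
replace ((c + a * / 2) * ((c + a * / 2) * 1) + - (m * / a)) with ((c + a / 2) ^ 2 - m / a) by (unfold Rdiv; ring).
field. split; lra.
Qed.

Lemma is_derive_esq c m a : adm c m a ->
  is_derive (esq c m) a (psq c m a / a).
Proof.
intros h. rewrite psq_eq by auto. assert (ha := proj1 h).
unfold esq. auto_derive; [lra|]. field. lra.
Qed.

(** * The derivative of the angle with respect to a *)

(* [flux] and its C-derivative [dflux] come from the Hermite reduction of the
   derivative of the third-kind integral: the primitive is [gflux] below, and
   [fint_da_identity] is the reduction with C = cos t and all square roots
   cleared. *)
Definition flux (a T h C : R) : R :=
  9*h^2*a^3 - 15*h^4*a - 3*T*h^2*a^2 - 8*T*h^4 + 3*T^2*a^3 - T^2*h^2*a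
  - T^3*a^2 - 4*T^4*a
  + C*h*(-9*h^2*a^2 + 12*h^4 - 6*T*h^2*a - 3*T^2*a^2 - 20*T^2*h^2
         - 2*T^3*a + 8*T^4)
  + C^2*h^2*(9*h^2*a + 12*T*h^2 + 3*T^2*a - 4*T^3).
Definition dflux (a T h C : R) : R :=
  h*(-9*h^2*a^2 + 12*h^4 - 6*T*h^2*a - 3*T^2*a^2 - 20*T^2*h^2
         - 2*T^3*a + 8*T^4)
  + 2*C*h^2*(9*h^2*a + 12*T*h^2 + 3*T^2*a - 4*T^3).

Lemma fint_da_identity (a T h C E D b Pi h' : R) :
  a <> 0 -> h <> 0 -> Pi <> 0 -> D <> 0 -> b <> 0 ->
  Pi = T^2 - h^2 -> E = h^2 + a*T - 3/4*a^2 ->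
  D = E - (a/2 - h*C)^2 -> b = T - h*C -> h' = (Pi - a*T)/(2*a*h) ->
  Pi/(2*a)/D - E*(Pi/a - 2*(a/2-h*C)*(1/2-h'*C))/D^2 - E*(3/2-h'*C)/(2*D*b)
  = - (4*b*(T^2+3*h^2+6*a*T) - (-4*T^3+12*T*h^2+3*a*T^2+9*a*h^2)*(1-C^2)) / (32*a*Pi*b)
   + (C*flux a T h C - (1-C^2)*dflux a T h C
      - (1-C^2)*flux a T h C*(- 2*(a/2-h*C)*h/D + h/(2*b))) / (16*a*h*Pi*D).
Proof.
intros ha hh hP hD hb eP eE eD eb eh.
apply Rmult_eq_reg_l with (32*a*h*Pi*b*D^2); [|repeat apply Rmult_integral_contrapositive_currified; try lra; apply pow_nonzero; auto].
rewrite eh.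
(* Denominators are cleared on each side while E, D, b and Pi are still atoms. Only afterwards are
   their values substituted, which leaves a polynomial identity in a, T, h and C. *)
transitivity (16*h*Pi*Pi*b*D - 16*E*(2*h*Pi - (a-2*h*C)*(a*h-(Pi-a*T)*C))*Pi*b - 8*E*(3*a*h-(Pi-a*T)*C)*Pi*D).
{ field; repeat split; auto. }
transitivity (-h*D^2*(4*b*(T^2+3*h^2+6*a*T) - (-4*T^3+12*T*h^2+3*a*T^2+9*a*h^2)*(1-C^2))
 + 2*b*D*(C*flux a T h C - (1-C^2)*dflux a T h C) - (1-C^2)*flux a T h C*(-2*(a-2*h*C)*h*b+h*D)).
2:{ field; repeat split; auto. }
subst. unfold flux, dflux. field.
Qed.

(** The derivative of [fint] in a, with both square roots factored out so that the remaining bracket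
    is the left side of [fint_da_identity]. *)
Definition fint_da (c m a t : R) : R :=
  (psq c m a / (2 * a) / den c m a t
   - esq c m a * (psq c m a / a
       - 2 * zed c m a t
         * (1 / 2 - (psq c m a - a * tmid c a) / (2 * a * hw c m a) * cos t))
     / den c m a t ^ 2
   - esq c m a * (3 / 2 - (psq c m a - a * tmid c a) / (2 * a * hw c m a) * cos t)
     / (2 * den c m a t * bed c m a t))
  / (sqrt (esq c m a) * sqrt (bed c m a t)).

Lemma is_derive_fint c m a t : 0 < m -> adm c m a ->
  is_derive (fun u => fint c m u t) a (fint_da c m a t).
Proof.
intros hm h. assert (dh := is_derive_hw _ _ _ h). assert (de := is_derive_esq _ _ _ h).
assert (hD := den_pos c m a t hm h). assert (hb := bed_pos c m a t hm h).
assert (hE := esq_pos c m a hm h).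
assert (h1 := hw_pos _ _ _ h).
assert (ha := proj1 h). unfold fint_da, fint. unfold den, bed, zed, tmid in *.
set (H' := (psq c m a - a * (c + 3 * a / 2)) / (2 * a * hw c m a)) in *.
set (P := psq c m a) in *.
assert (sb := sqrt_lt_R0 _ hb). assert (sE := sqrt_lt_R0 _ hE).
assert (qb := sqrt_sqrt _ (Rlt_le _ _ hb)). assert (qE := sqrt_sqrt _ (Rlt_le _ _ hE)).
auto_derive.
- repeat split; auto.
  + now exists (P / a).
  + now exists (P / a).
  + now exists H'.
  + now exists H'.
  + apply Rmult_integral_contrapositive_currified; apply Rgt_not_eq.
    * unfold Rdiv in *. simpl in *. lra.
    * unfold Rdiv in *. exact sb.
- replace (Derive (fun x : R => hw c m x) a) with H'
    by (symmetry; exact (is_derive_unique _ _ _ dh)).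
  replace (Derive (fun x : R => esq c m x) a) with (P / a)
    by (symmetry; exact (is_derive_unique _ _ _ de)).
  change (c + 3 * a * / 2) with (c + 3 * a / 2).
  change (a * / 2) with (a / 2).
  replace (esq c m a + - ((a / 2 + - (hw c m a * cos t)) * ((a / 2 + - (hw c m a * cos t)) * 1)))
    with (esq c m a - (a / 2 - hw c m a * cos t) ^ 2) by ring.
  replace (c + 3 * a / 2 + - (hw c m a * cos t)) with (c + 3 * a / 2 - hw c m a * cos t) by ring.
  set (D := esq c m a - _) in *. set (b := c + _ - _) in *.
  set (q := sqrt b) in *. set (e := sqrt (esq c m a)) in *.
  clearbody D q e b.
  (* Writing the radicands as squares of their roots turns the goal into a rational identity. *)
  replace b with (q * q) by lra. replace (esq c m a) with (e * e) by lra.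
  field. repeat split; lra.
Qed.

Definition gflux (c m a t : R) : R :=
  sin t * flux a (tmid c a) (hw c m a) (cos t)
  / (16 * a * hw c m a * psq c m a * (sqrt (bed c m a t) * den c m a t * sqrt (esq c m a))).

(** The part of the reduction that is not exact, with its sign reversed. The factor [den] has
    cancelled, so only an integral of the second kind remains. *)
Definition loss (c m a t : R) : R :=
  (4 * bed c m a t * (tmid c a ^ 2 + 3 * hw c m a ^ 2 + 6 * a * tmid c a)
   - (- 4 * tmid c a ^ 3 + 12 * tmid c a * hw c m a ^ 2
      + 3 * a * tmid c a ^ 2 + 9 * a * hw c m a ^ 2) * sin t ^ 2)
  / (32 * a * psq c m a * bed c m a t * (sqrt (esq c m a) * sqrt (bed c m a t))).

Lemma is_derive_gflux c m a t : 0 < m -> adm c m a ->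
  is_derive (gflux c m a) t (fint_da c m a t + loss c m a t).
Proof.
intros hm h.
assert (hD := den_pos c m a t hm h). assert (hb := bed_pos c m a t hm h).
assert (hE := esq_pos c m a hm h). assert (h1 := hw_pos _ _ _ h).
assert (hP := psq_pos c m a hm h). assert (ha := proj1 h).
assert (eE := esq_hw c m a h).
assert (sc := sin2_cos2 t). unfold Rsqr in sc.
assert (sb := sqrt_lt_R0 _ hb). assert (sE := sqrt_lt_R0 _ hE).
assert (qb := sqrt_sqrt _ (Rlt_le _ _ hb)).
assert (K := fint_da_identity a (tmid c a) (hw c m a) (cos t) (esq c m a) (den c m a t) (bed c m a t)
  (psq c m a) ((psq c m a - a * tmid c a) / (2 * a * hw c m a))
  ltac:(lra) ltac:(lra) ltac:(lra) ltac:(lra) ltac:(lra) eq_refl eE eq_refl eq_refl eq_refl).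
unfold fint_da, loss, gflux.
change (a / 2 - hw c m a * cos t) with (zed c m a t) in K. rewrite K. clear K.
unfold den, bed, zed in *.
set (P := psq c m a) in *. set (T := tmid c a) in *. set (E := esq c m a) in *.
set (h0 := hw c m a) in *. set (e := sqrt E) in *. unfold flux, dflux.
assert (rD : E + - ((a / 2 + - (h0 * cos t)) * ((a / 2 + - (h0 * cos t)) * 1))
  = E - (a / 2 - h0 * cos t) ^ 2) by field.
assert (rb : T + - (h0 * cos t) = T - h0 * cos t) by ring.
auto_derive; rewrite ?rD, ?rb.
- repeat split; auto.
  apply Rgt_not_eq. repeat apply Rmult_lt_0_compat; auto; lra.
- clear rD rb.
  set (C := cos t) in *. set (s := sin t) in *.
  replace (s ^ 2) with (1 - C ^ 2) by lra.
  set (D := E - _) in *. set (b := T - _) in *. set (q := sqrt b) in *.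
  replace (1 - C ^ 2) with (s ^ 2) by lra.
  replace b with (q * q) by lra.
  field. repeat split; lra.
Qed.

(** Let X = T^2 + 3 h^2 + 6 a T, and let Y be the coefficient of sin^2 t in the numerator 4 [bed] X
    - Y sin^2 t. From Y < 2 T X and T sin^2 t <= 2 [bed] it follows that Y sin^2 t < 4 [bed] X where
    sin t is nonzero. Where sin t = 0 the numerator is 4 [bed] X. *)
Lemma loss_pos c m a t : 0 < m -> adm c m a -> 0 < loss c m a t.
Proof.
intros hm h. unfold loss.
assert (hb := bed_pos c m a t hm h).
assert (hE := esq_pos c m a hm h). assert (h1 := hw_pos _ _ _ h).
assert (hP := psq_pos c m a hm h). assert (ha := proj1 h).
assert (h2 := hw_lt _ _ _ hm h).
assert (sb := sqrt_lt_R0 _ hb). assert (sE := sqrt_lt_R0 _ hE).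
assert (sc := sin2_cos2 t). unfold Rsqr in sc. assert (hC := COS_bound t).
apply Rdiv_lt_0_compat; [|repeat apply Rmult_lt_0_compat; lra].
assert (hT : hw c m a < tmid c a) by (unfold tmid; lra). unfold bed.
set (T := tmid c a) in *. set (h0 := hw c m a) in *. set (C := cos t) in *.
assert (e1 : T * sin t ^ 2 <= 2 * (T - h0 * C)).
{ replace (sin t ^ 2) with (1 - C ^ 2) by lra. destruct (Rle_or_lt 0 C).
  (* For C >= 0, 2 (T - h C) - T (1 - C^2) = 2 (T - h) C + T (1 - C)^2; for C < 0 it is -2 h C + T
     (1 + C^2). *)
  - assert (0 <= (T - h0) * C) by (apply Rmult_le_pos; lra).
    assert (0 <= T * (1 - C) ^ 2) by (apply Rmult_le_pos; [lra|apply pow2_ge_0]). lra.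
  - assert (0 < h0 * - C) by (apply Rmult_lt_0_compat; lra).
    assert (0 <= T * (1 + C ^ 2)) by (apply Rmult_le_pos; [lra|nra]). lra. }
assert (e2 : - 4 * T ^ 3 + 12 * T * h0 ^ 2 + 3 * a * T ^ 2 + 9 * a * h0 ^ 2
  < 2 * T * (T ^ 2 + 3 * h0 ^ 2 + 6 * a * T)).
(* The difference of the two sides is exactly this product. *)
{ assert (0 < (T ^ 2 - h0 ^ 2) * (6 * T + 9 * a)) by (apply Rmult_lt_0_compat; nra). lra. }
set (X := T ^ 2 + 3 * h0 ^ 2 + 6 * a * T) in *.
assert (hX : 0 < X) by (unfold X; nra).
assert (hb' : 0 < T - h0 * C) by (unfold bed in hb; exact hb).
assert (hs := pow2_ge_0 (sin t)). destruct hs as [hs|hs].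
- apply Rlt_0_minus. apply Rlt_le_trans with (2 * T * X * sin t ^ 2).
  + apply Rmult_lt_compat_r; auto.
  + replace (2 * T * X * sin t ^ 2) with (2 * X * (T * sin t ^ 2)) by ring. nra.
- rewrite <- hs. nra.
Qed.

(** * Differentiation under the integral sign and monotonicity in a *)

Lemma continuous_pos_locally (f : R -> R) x :
  continuous f x -> 0 < f x -> locally x (fun y => 0 < f y).
Proof. intros hf hx. apply hf. now apply open_gt. Qed.

Lemma adm_locally c m a : adm c m a -> locally a (adm c m).
Proof.
intros (h1 & h2 & h3).
assert (l1 : locally a (fun y => 0 < y)) by now apply open_gt.
assert (l2 : locally a (fun y => 0 < c + y / 2)).
{ apply (continuous_pos_locally (fun y => c + y / 2)); [|auto].
  apply @ex_derive_continuous. auto_derive. auto. }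
assert (l3 : locally a (fun y => 0 < y * (c + y / 2) ^ 2 - m)).
{ apply (continuous_pos_locally (fun y => y * (c + y / 2) ^ 2 - m)); [|lra].
  apply @ex_derive_continuous. auto_derive. auto. }
generalize (filter_and _ _ l1 (filter_and _ _ l2 l3)). apply filter_imp.
intros y (k1 & k2 & k3). repeat split; auto. lra.
Qed.

Lemma ex_derive_fint_t c m a t : 0 < m -> adm c m a -> ex_derive (fint c m a) t.
Proof.
intros hm h. assert (hD := den_pos c m a t hm h). assert (hb := bed_pos c m a t hm h).
assert (sb := sqrt_lt_R0 _ hb).
unfold fint, den, bed, zed in *. auto_derive.
replace (esq c m a + - ((a / 2 + - (hw c m a * cos t)) * ((a / 2 + - (hw c m a * cos t)) * 1)))
  with (esq c m a - (a / 2 - hw c m a * cos t) ^ 2) by field.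
replace (tmid c a + - (hw c m a * cos t)) with (tmid c a - hw c m a * cos t) by ring.
repeat split; auto. apply Rgt_not_eq. now apply Rmult_lt_0_compat.
Qed.

Lemma ex_RInt_fint c m a x y : 0 < m -> adm c m a -> ex_RInt (fint c m a) x y.
Proof.
intros hm h. apply @ex_RInt_continuous. intros t _.
apply @ex_derive_continuous. now apply ex_derive_fint_t.
Qed.

(** Rules for joint continuity: [is_derive_RInt_param] asks for it in the parameter and the
    integration variable together. *)
Lemma continuity_2d_fst (f : R -> R) x y :
  continuity_pt f x -> continuity_2d_pt (fun u _ => f u) x y.
Proof.
intros h. apply (continuity_1d_2d_pt_comp f (fun u _ => u)); auto.
apply continuity_2d_pt_id1.
Qed.

Lemma continuity_2d_snd (f : R -> R) x y :
  continuity_pt f y -> continuity_2d_pt (fun _ v => f v) x y.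
Proof.
intros h. apply (continuity_1d_2d_pt_comp f (fun _ v => v)); auto.
apply continuity_2d_pt_id2.
Qed.

Lemma continuity_2d_sqrt (f : R -> R -> R) x y : 0 < f x y ->
  continuity_2d_pt f x y -> continuity_2d_pt (fun u v => sqrt (f u v)) x y.
Proof.
intros h hf. apply (continuity_1d_2d_pt_comp sqrt f); auto.
apply continuity_pt_sqrt. lra.
Qed.

Lemma continuity_2d_div (f g : R -> R -> R) x y : g x y <> 0 ->
  continuity_2d_pt f x y -> continuity_2d_pt g x y ->
  continuity_2d_pt (fun u v => f u v / g u v) x y.
Proof.
intros h hf hg. apply continuity_2d_pt_mult; auto. now apply continuity_2d_pt_inv.
Qed.

Lemma continuity_2d_sq (f : R -> R -> R) x y :
  continuity_2d_pt f x y -> continuity_2d_pt (fun u v => f u v ^ 2) x y.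
Proof.
intros hf. apply (continuity_1d_2d_pt_comp (fun z => z ^ 2) f); auto.
apply derivable_continuous_pt, derivable_pt_pow.
Qed.

Lemma is_derive_continuity_pt (f : R -> R) x l : is_derive f x l -> continuity_pt f x.
Proof.
intros h. apply continuity_pt_filterlim. apply (ex_derive_continuous f). now exists l.
Qed.

Lemma continuity_pt_hw c m a : adm c m a -> continuity_pt (hw c m) a.
Proof. intros h. eapply is_derive_continuity_pt. now apply is_derive_hw. Qed.

Lemma continuity_pt_esq c m a : adm c m a -> continuity_pt (esq c m) a.
Proof. intros h. eapply is_derive_continuity_pt. now apply is_derive_esq. Qed.

Lemma continuity_2d_fint_da c m a t : 0 < m -> adm c m a ->
  continuity_2d_pt (fint_da c m) a t.
Proof.
intros hm h.
assert (hD := den_pos c m a t hm h). assert (hb := bed_pos c m a t hm h).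
assert (hE := esq_pos c m a hm h). assert (h1 := hw_pos _ _ _ h). assert (ha := proj1 h).
assert (sb := sqrt_lt_R0 _ hb). assert (sE := sqrt_lt_R0 _ hE).
assert (ch := continuity_2d_fst _ a t (continuity_pt_hw _ _ _ h)).
assert (ce := continuity_2d_fst _ a t (continuity_pt_esq _ _ _ h)).
assert (ci := continuity_2d_pt_id1 a t).
assert (cc : continuity_2d_pt (fun _ v => cos v) a t)
  by (apply continuity_2d_snd, continuity_cos).
assert (cT : continuity_2d_pt (fun u _ => tmid c u) a t).
{ apply continuity_2d_fst. unfold tmid. apply continuity_pt_filterlim.
  apply (ex_derive_continuous (fun u => c + 3 * u / 2)). auto_derive. auto. }
assert (cP : continuity_2d_pt (fun u _ => psq c m u) a t).
{ unfold psq. apply continuity_2d_pt_minus; now apply continuity_2d_sq. }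
assert (cz : continuity_2d_pt (fun u v => zed c m u v) a t).
{ unfold zed. apply continuity_2d_pt_minus.
  - apply continuity_2d_div; [lra| exact ci | apply continuity_2d_pt_const].
  - now apply continuity_2d_pt_mult. }
assert (cb : continuity_2d_pt (fun u v => bed c m u v) a t).
{ unfold bed. apply continuity_2d_pt_minus; [exact cT|]. now apply continuity_2d_pt_mult. }
assert (cD : continuity_2d_pt (fun u v => den c m u v) a t).
{ unfold den. apply continuity_2d_pt_minus; [exact ce|]. now apply continuity_2d_sq. }
unfold fint_da.
repeat first [ assumption | apply continuity_2d_pt_const | apply continuity_2d_sqrt
  | apply continuity_2d_sq | apply continuity_2d_pt_minus | apply continuity_2d_div
  | apply continuity_2d_pt_mult ];
  try (apply Rgt_not_eq; try apply pow_lt; repeat apply Rmult_lt_0_compat; lra).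
Qed.

(** The progression angle is 4 r times this integral, by [progression_angle_param]. *)
Definition lam (c m a : R) : R := RInt (fint c m a) 0 PI.

Lemma is_derive_lam c m a : 0 < m -> adm c m a ->
  is_derive (lam c m) a (RInt (fint_da c m a) 0 PI).
Proof.
intros hm h.
assert (D : forall u, adm c m u -> forall t, Derive (fun z => fint c m z t) u = fint_da c m u t)
  by (intros u hu t; apply is_derive_unique; now apply is_derive_fint).
rewrite <- (RInt_ext (fun t => Derive (fun u => fint c m u t) a)) by (intros; now apply D).
apply (is_derive_RInt_param (fint c m)).
- generalize (adm_locally _ _ _ h). apply filter_imp. intros u hu t _.
  exists (fint_da c m u t). now apply is_derive_fint.
- intros t _. apply continuity_2d_pt_ext_loc with (fint_da c m).
  + destruct (adm_locally _ _ _ h) as [d hd]. exists d. intros u v hu _.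
    symmetry. apply D, hd. exact hu.
  + now apply continuity_2d_fint_da.
- generalize (adm_locally _ _ _ h). apply filter_imp. intros u hu.
  now apply ex_RInt_fint.
Qed.

Lemma continuous_loss c m a t : 0 < m -> adm c m a -> continuous (loss c m a) t.
Proof.
intros hm h. assert (hb := bed_pos c m a t hm h).
assert (hE := esq_pos c m a hm h). assert (hP := psq_pos c m a hm h).
assert (ha := proj1 h).
assert (sb := sqrt_lt_R0 _ hb). assert (sE := sqrt_lt_R0 _ hE).
unfold loss, bed in *. apply @ex_derive_continuous. auto_derive.
replace (tmid c a + - (hw c m a * cos t)) with (tmid c a - hw c m a * cos t) by ring.
repeat split; auto. apply Rgt_not_eq. repeat apply Rmult_lt_0_compat; auto; lra.
Qed.

(** The exact part integrates to zero because [gflux] carries the factor sin t, which vanishes at 0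
    and at pi. The integral is therefore minus that of the positive [loss]. *)
Lemma RInt_fint_da_neg c m a : 0 < m -> adm c m a -> RInt (fint_da c m a) 0 PI < 0.
Proof.
intros hm h.
assert (cl : forall t, continuous (loss c m a) t) by (intros; now apply continuous_loss).
assert (cf : forall t, continuous (fint_da c m a) t).
{ intros t. apply continuity_pt_filterlim.
  intros eps heps. destruct (continuity_2d_fint_da c m a t hm h (mkposreal eps heps)) as [d hd].
  exists d. split; [apply cond_pos|]. intros x [_ hx]. apply hd; [|exact hx].
  rewrite Rminus_diag, Rabs_R0. apply cond_pos. }
assert (I1 : is_RInt (fun t => fint_da c m a t + loss c m a t) 0 PI
  (gflux c m a PI - gflux c m a 0)).
{ apply (is_RInt_derive (gflux c m a)).
  - intros t _. now apply is_derive_gflux.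
  - intros t _. now apply @continuous_plus. }
assert (e0 : gflux c m a PI - gflux c m a 0 = 0).
{ unfold gflux. rewrite sin_PI, sin_0. unfold Rdiv. ring. }
rewrite e0 in I1. apply (is_RInt_unique (V := R_CompleteNormedModule)) in I1.
rewrite (RInt_plus (V := R_CompleteNormedModule) (fint_da c m a) (loss c m a)) in I1;
  try (apply @ex_RInt_continuous; auto).
assert (0 < RInt (loss c m a) 0 PI).
{ apply RInt_gt_0; [apply PI_RGT_0| |]; intros; auto. now apply loss_pos. }
unfold plus in I1. simpl in I1. lra.
Qed.

Lemma adm_mono c m a u : 0 < m -> adm c m a -> a <= u -> adm c m u.
Proof.
intros hm (h1 & h2 & h3) hu. repeat split; try lra.
apply Rlt_le_trans with (1 := h3). apply Rmult_le_compat; try lra.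
- apply pow2_ge_0.
- apply pow_incr. lra.
Qed.

Lemma lam_decr c m a u : 0 < m -> adm c m a -> a < u -> lam c m u < lam c m a.
Proof.
intros hm h hu.
assert (d : forall x, Rmin a u <= x -> is_derive (lam c m) x (RInt (fint_da c m x) 0 PI)).
{ intros x hx. rewrite Rmin_left in hx by lra. apply is_derive_lam; auto.
  now apply adm_mono with a. }
destruct (MVT_gen (lam c m) a u (fun x => RInt (fint_da c m x) 0 PI)) as (x & hx & e).
- intros x hx. apply d. lra.
- intros x hx. eapply is_derive_continuity_pt. apply d. lra.
- rewrite Rmin_left in hx by lra.
  assert (n := RInt_fint_da_neg c m x hm (adm_mono c m a x hm h (proj1 hx))). nra.
Qed.

(** * The lower bound pi *)

(** With B = [bed] - a, the left side minus m is -r^2 times the cubic at B. The root -a contributes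
    the factor [bed], and the two positive roots contribute h^2 - h^2 cos^2 t. *)
Lemma chord_product c m a t : adm c m a ->
  (bed c m a t - a) * den c m a t = m + bed c m a t * (hw c m a * sin t) ^ 2.
Proof.
intros h. rewrite den_eq by auto.
assert (e : a * ((tmid c a - a) ^ 2 - hw c m a ^ 2) = m).
{ rewrite hw_sq by auto. unfold hsq, tmid. field. apply Rgt_not_eq, h. }
assert (sc := sin2_cos2 t). unfold Rsqr in sc.
unfold bed. transitivity (a * ((tmid c a - a) ^ 2 - hw c m a ^ 2)
  + (tmid c a - hw c m a * cos t) * (hw c m a * sin t) ^ 2); [|rewrite e; reflexivity].
clear e. set (T := tmid c a). set (k := hw c m a).
set (C := cos t) in *. set (s := sin t) in *.
replace ((k * s) ^ 2) with (k ^ 2 * s ^ 2) by ring.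
replace (s ^ 2) with (1 - C ^ 2) by lra. ring.
Qed.

Lemma zed_lt c m a t : 0 < m -> adm c m a -> - sqrt (esq c m a) < zed c m a t < sqrt (esq c m a).
Proof.
intros hm h. assert (hD := den_pos c m a t hm h). assert (hE := esq_pos c m a hm h).
unfold den in hD. assert (sE := sqrt_lt_R0 _ hE). assert (qE := sqrt_sqrt _ (Rlt_le _ _ hE)).
split; apply Rnot_le_lt; intros n; nra.
Qed.

Lemma den_factor c m a t : 0 < m -> adm c m a ->
  den c m a t = (sqrt (esq c m a) - zed c m a t) * (sqrt (esq c m a) + zed c m a t).
Proof.
intros hm h. assert (hE := esq_pos c m a hm h).
assert (qE := sqrt_sqrt _ (Rlt_le _ _ hE)). unfold den. nra.
Qed.

(* With w = e - (B - c) and H = c + e, where e^2 = [esq], this is 2 e H w - m, an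
   upper bound of B [den] - m in which B has been replaced by H and [den] by 2 e w. *)
Definition vsq (c m a t : R) : R :=
  2 * sqrt (esq c m a) * (c + sqrt (esq c m a)) * (sqrt (esq c m a) - zed c m a t) - m.

Lemma vsq_ge c m a t : 0 < m -> adm c m a ->
  bed c m a t * (hw c m a * sin t) ^ 2 < vsq c m a t.
Proof.
intros hm h. assert (e := chord_product c m a t h). rewrite den_factor in e by auto.
assert (hz := zed_lt c m a t hm h). unfold vsq.
assert (eb : bed c m a t - a = c + zed c m a t) by (unfold bed, zed, tmid; field).
rewrite eb in e. assert (h2 := hw_lt _ _ _ hm h).
assert (hb := bed_bounds c m a t h). unfold tmid in hb.
set (x := sqrt (esq c m a)) in *. set (z := zed c m a t) in *.
assert (0 < c + z) by lra. assert ((c + z) * (x + z) < (c + x) * (2 * x)) by nra.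
assert ((x - z) * ((c + z) * (x + z)) < (x - z) * ((c + x) * (2 * x)))
  by (apply Rmult_lt_compat_l; lra).
lra.
Qed.

Lemma vsq_pos c m a t : 0 < m -> adm c m a -> 0 < vsq c m a t.
Proof.
intros hm h. apply Rle_lt_trans with (2 := vsq_ge c m a t hm h).
apply Rmult_le_pos; [apply Rlt_le; now apply bed_pos|apply pow2_ge_0].
Qed.

(** With w = e - [zed] and e^2 = [esq], the estimates [den] <= 2 e w and sqrt([bed]) h sin t <=
    sqrt([vsq]) bound the integrand below by J. The function J is the derivative of -2 atan
    (sqrt([vsq]) / (2 r)). *)
Lemma lam_ge_atan c m r a : 0 < r -> m = 4 * r ^ 2 -> adm c m a ->
  2 * (atan (sqrt (vsq c m a 0) / (2 * r))
       - atan (sqrt (vsq c m a PI) / (2 * r)))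
  <= 4 * r * lam c m a.
Proof.
intros hr em h. assert (hm : 0 < m) by nra.
set (w t := sqrt (esq c m a) - zed c m a t).
set (J t := 2 * r * (hw c m a * sin t) / (w t * sqrt (vsq c m a t))).
assert (hw0 : forall t, 0 < w t) by (intros t; assert (hz := zed_lt c m a t hm h); unfold w; lra).
assert (hv : forall t, 0 < vsq c m a t) by (intros; now apply vsq_pos).
assert (hsv : forall t, 0 < sqrt (vsq c m a t)) by (intros; now apply sqrt_lt_R0).
assert (hE := esq_pos c m a hm h). assert (sE := sqrt_lt_R0 _ hE).
assert (I1 : is_RInt J 0 PI
  (- 2 * atan (sqrt (vsq c m a PI) / (2 * r)) - - 2 * atan (sqrt (vsq c m a 0) / (2 * r)))).
{ apply (is_RInt_derive (fun t => - 2 * atan (sqrt (vsq c m a t) / (2 * r)))).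
  - intros t _. unfold J. specialize (hw0 t). specialize (hv t). specialize (hsv t).
    assert (qv := sqrt_sqrt _ (Rlt_le _ _ hv)).
    unfold w, vsq, zed in *.
    set (x := sqrt (esq c m a)) in *. set (k := hw c m a) in *.
    assert (rv : 2 * x * (c + x) * (x + - (a / 2 + - (k * cos t))) + - m =
       2 * x * (c + x) * (x - (a / 2 - k * cos t)) - m) by ring.
    auto_derive; rewrite ?rv.
    + repeat split; auto; lra.
    + set (V := sqrt (_ - m)) in *.
      (* Since m = (2 r)^2, the denominator 1 + [vsq] / m in the derivative of the arctangent is the
         product 2 e (c + e) w / m. Its factor e (c + e) cancels against the derivative of [vsq]. *)
      assert (ew : 1 + V * / (2 * r) * (V * / (2 * r)) =
        2 * x * (c + x) * (x - (a / 2 - k * cos t)) / m).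
      { replace (2 * x * (c + x) * (x - (a / 2 - k * cos t))) with (V * V + m) by lra.
        rewrite em. field. lra. }
      replace (V * / (2 * r) * (V * / (2 * r) * 1)) with (V * / (2 * r) * (V * / (2 * r))) by ring.
      rewrite ew.
      assert (0 < c + x).
      { apply Rnot_le_lt. intros n.
        assert (0 <= x * (x - (a / 2 - k * cos t)) * - (c + x)) by
          (repeat apply Rmult_le_pos; lra). lra. }
      rewrite em. field. repeat split; lra.
  - intros t _. specialize (hw0 t). specialize (hv t). specialize (hsv t).
    unfold J, w, vsq, zed in *. apply @ex_derive_continuous.
    set (x := sqrt (esq c m a)) in *. set (k := hw c m a) in *.
    assert (rv : 2 * x * (c + x) * (x + - (a / 2 + - (k * cos t))) + - m =
       2 * x * (c + x) * (x - (a / 2 - k * cos t)) - m) by ring.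
    auto_derive; rewrite ?rv.
    repeat split; auto. apply Rgt_not_eq. now apply Rmult_lt_0_compat. }
assert (I2 : is_RInt (fun t => 4 * r * fint c m a t) 0 PI (4 * r * lam c m a)).
{ apply (is_RInt_scal (fint c m a)). apply (RInt_correct (fint c m a)). now apply ex_RInt_fint. }
match type of I1 with is_RInt _ _ _ ?v => apply Rle_trans with v; [lra|] end.
apply (is_RInt_le _ _ 0 PI _ _ (Rlt_le _ _ PI_RGT_0) I1 I2).
intros t ht. unfold J, fint.
assert (hb := bed_pos c m a t hm h). assert (sb := sqrt_lt_R0 _ hb).
assert (hD := den_pos c m a t hm h). assert (hz := zed_lt c m a t hm h).
assert (e1 : den c m a t <= 2 * sqrt (esq c m a) * w t).
{ rewrite den_factor by auto. unfold w. nra. }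
assert (hs : 0 <= hw c m a * sin t).
{ apply Rmult_le_pos; [apply sqrt_pos|]. apply Rlt_le. now apply sin_gt_0. }
assert (e2 : sqrt (bed c m a t) * (hw c m a * sin t) <= sqrt (vsq c m a t)).
{ rewrite <- (sqrt_pow2 (hw c m a * sin t)) by auto. rewrite <- sqrt_mult by (try apply pow2_ge_0; lra).
  apply sqrt_le_1_alt. apply Rlt_le. now apply vsq_ge. }
specialize (hw0 t). specialize (hsv t).
apply Rmult_le_reg_r with (w t * sqrt (vsq c m a t) * (den c m a t * sqrt (bed c m a t))).
{ repeat apply Rmult_lt_0_compat; auto. }
apply Rle_trans with (2 * r * (den c m a t * (sqrt (bed c m a t) * (hw c m a * sin t)))).
{ right. field. lra. }
apply Rle_trans with (2 * r * (2 * sqrt (esq c m a) * w t * sqrt (vsq c m a t))).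
2:{ right. field. split; lra. }
apply Rmult_le_compat_l; [lra|]. apply Rmult_le_compat; auto; try lra.
apply Rmult_le_pos; lra.
Qed.

(** As a grows, [vsq] tends to infinity at t = 0 and to 0 at t = pi. The two arctangents in
    [lam_ge_atan] thus tend to pi/2 and 0, and the lower bound tends to pi. *)
Lemma vsq_asymptotic c m a : 0 < m -> 1 <= a -> 4 * Rabs c <= a -> 16 * m < a ->
  adm c m a /\ a / 40 - m <= vsq c m a 0 /\ vsq c m a PI <= 256 * m ^ 2 / a.
Proof.
intros hm h1 hc hma.
assert (hc' : - a / 4 <= c <= a / 4).
{ assert (x := Rle_abs c). assert (y := Rle_abs (- c)). rewrite Rabs_Ropp in y. lra. }
assert (a3 : a <= a ^ 3) by nra.
assert (h : adm c m a).
{ repeat split; try lra.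
  assert (a * (a / 4) ^ 2 <= a * (c + a / 2) ^ 2); [|lra].
  apply Rmult_le_compat_l; [lra|]. apply pow_incr. lra. }
split; auto.
assert (hd : m / a <= a ^ 2 / 16).
{ apply Rmult_le_reg_r with a; [lra|]. replace (m / a * a) with m by (field; lra). lra. }
assert (hd0 : 0 < m / a) by (apply Rdiv_lt_0_compat; lra).
assert (hE := esq_pos c m a hm h). assert (sE := sqrt_lt_R0 _ hE).
assert (qE := sqrt_sqrt _ (Rlt_le _ _ hE)).
assert (k1 := hw_pos _ _ _ h). assert (k2 := hw_lt _ _ _ hm h).
assert (z0 := zed_lt c m a 0 hm h). assert (zP := zed_lt c m a PI hm h).
assert (D0 := den_factor c m a 0 hm h).
rewrite den_eq in D0 by auto.
assert (CP := chord_product c m a PI h). rewrite den_factor in CP by auto.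
unfold vsq, zed, bed, tmid in *.
rewrite ?cos_0, ?sin_0, ?cos_PI, ?sin_PI in *.
set (e := sqrt (esq c m a)) in *. set (k := hw c m a) in *.
assert (e1 : a / 2 <= e).
{ apply Rnot_lt_le. intros n. unfold esq in qE.
  assert ((a - a / 4) ^ 2 <= (c + a) ^ 2) by (apply pow_incr; lra).
  assert (e * e < a / 2 * (a / 2)) by (apply Rmult_gt_0_lt_compat; lra).
  assert (0 < a ^ 2) by (apply pow_lt; lra). lra. }
assert (e2 : e <= c + a).
{ apply Rnot_lt_le. intros n. unfold esq in qE.
  assert ((c + a) * (c + a) < e * e) by (apply Rmult_gt_0_lt_compat; lra). lra. }
split.
(* At t = 0, [den] = w (e + [zed]) is at least a^2 / 4, while e + [zed] is at most 5 a / 2. *)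
- assert (w0 : a / 10 <= e - (a / 2 - k * 1)).
  { apply Rnot_lt_le. intros n.
    assert (a * (a / 4) <= a * (c + 3 * a / 2 - a + k * 1)) by (apply Rmult_le_compat_l; lra).
    assert ((e - (a / 2 - k * 1)) * (e + (a / 2 - k * 1)) < a / 10 * (a * (5 / 2))).
    { apply Rmult_gt_0_lt_compat; try lra. }
    lra. }
  assert (2 * (a / 2) * (a / 4) * (a / 10) <= 2 * e * (c + e) * (e - (a / 2 - k * 1))); [|lra].
  assert (0 <= a * a) by nra.
  assert (a * (a / 4) <= 2 * e * (c + e)) by (apply Rmult_le_compat; lra).
  replace (2 * (a / 2)) with a by field. apply Rmult_le_compat; lra.
- set (w := e - (a / 2 - k * -1)) in *.
  assert (hw' : 0 < w) by (unfold w; lra).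
  (* At t = pi, B is the root A_1 and [chord_product] reads B w (e + [zed]) = m, with B >= a / 4 and
     e + [zed] >= a / 2. *)
  assert (w1 : w <= 8 * m / a ^ 2).
  { apply Rmult_le_reg_r with (a ^ 2); [nra|].
    replace (8 * m / a ^ 2 * a ^ 2) with (8 * m) by (field; lra).
    assert ((a / 4) * (w * (a / 2)) <= m); [|lra].
    apply Rle_trans with ((c + 3 * a / 2 - k * -1 - a) * (w * (e + (a / 2 - k * -1)))); [|lra].
    apply Rmult_le_compat; try lra.
    - apply Rmult_le_pos; lra.
    - apply Rmult_le_compat_l; lra. }
  (* Inserting m = (c + e - w) w (2 e - w) cancels the terms linear in w, so [vsq] is of second
     order in the small quantity w. *)
  replace (2 * e * (c + e) * w - m) with (w ^ 2 * (c + 3 * e - w)) by (unfold w in *; lra).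
  apply Rle_trans with ((8 * m / a ^ 2) ^ 2 * (4 * a)).
  + apply Rmult_le_compat; try lra.
    * apply pow2_ge_0.
    * unfold w. lra.
    * apply pow_incr. lra.
  + replace ((8 * m / a ^ 2) ^ 2 * (4 * a)) with (256 * m ^ 2 / a ^ 3) by (field; lra).
    apply Rmult_le_compat_l; [nra|]. apply Rinv_le_contravar; lra.
Qed.

Lemma lam_asymptotic c r eps M : 0 < r -> 0 < eps < 1 ->
  exists a, M <= a /\ adm c (4 * r ^ 2) a /\ PI - eps < 4 * r * lam c (4 * r ^ 2) a.
Proof.
intros hr he. set (m := 4 * r ^ 2). assert (hm : 0 < m) by (unfold m; nra).
assert (pi2 := PI2_1).
(* The thresholds x and y put the two arctangents within eps / 4 of pi/2 and of 0. In the choice of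
   a, the term 40 (m + x^2) handles x and the last one handles y. The others give M <= a and the
   hypotheses of [vsq_asymptotic]. *)
set (x := 2 * r * tan (PI / 2 - eps / 4)). set (y := 2 * r * tan (eps / 4)).
assert (hx : 0 < x) by (apply Rmult_lt_0_compat; [lra|]; apply tan_gt_0; lra).
assert (hy : 0 < y) by (apply Rmult_lt_0_compat; [lra|]; apply tan_gt_0; lra).
set (a := 1 + Rabs M + 4 * Rabs c + 16 * m + 40 * (m + x ^ 2) + 256 * m ^ 2 / y ^ 2).
assert (p1 := Rabs_pos M). assert (p2 := Rabs_pos c). assert (p3 := Rle_abs M).
assert (p4 : 0 < 256 * m ^ 2 / y ^ 2) by (apply Rdiv_lt_0_compat; nra).
assert (p5 := pow2_ge_0 x).
destruct (vsq_asymptotic c m a hm) as (h & v0 & v1); try (unfold a; lra).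
exists a. split; [unfold a; lra|]. split; auto.
apply Rlt_le_trans with (2 := lam_ge_atan c m r a hr eq_refl h).
assert (q0 : PI / 2 - eps / 4 < atan (sqrt (vsq c m a 0) / (2 * r))).
{ rewrite <- (atan_tan (PI / 2 - eps / 4)) by lra. apply atan_increasing.
  apply Rmult_lt_reg_l with (2 * r); [lra|].
  replace (2 * r * (sqrt (vsq c m a 0) / (2 * r))) with (sqrt (vsq c m a 0)) by (field; lra).
  fold x. rewrite <- (sqrt_pow2 x) by lra. apply sqrt_lt_1_alt. split; auto.
  apply Rlt_le_trans with (2 := v0). unfold a. lra. }
assert (q1 : atan (sqrt (vsq c m a PI) / (2 * r)) < eps / 4).
{ rewrite <- (atan_tan (eps / 4)) by lra. apply atan_increasing.
  apply Rmult_lt_reg_l with (2 * r); [lra|].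
  replace (2 * r * (sqrt (vsq c m a PI) / (2 * r))) with (sqrt (vsq c m a PI)) by (field; lra).
  fold y. rewrite <- (sqrt_pow2 y) by lra. apply sqrt_lt_1_alt. split.
  - apply Rlt_le. now apply vsq_pos.
  - apply Rle_lt_trans with (1 := v1).
    assert (ha : 256 * m ^ 2 / y ^ 2 < a) by (unfold a; lra).
    apply Rmult_lt_reg_r with (a / y ^ 2); [apply Rdiv_lt_0_compat; nra|].
    replace (256 * m ^ 2 / a * (a / y ^ 2)) with (256 * m ^ 2 / y ^ 2) by (field; split; lra).
    replace (y ^ 2 * (a / y ^ 2)) with a by (field; lra). exact ha. }
lra.
Qed.

(** If the angle at a + 1 were below pi, it would stay below that value for all larger a,
    contradicting [lam_asymptotic]. The step from a to a + 1 makes the inequality strict. *)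
Lemma lam_gt_PI c r a : 0 < r -> adm c (4 * r ^ 2) a -> PI < 4 * r * lam c (4 * r ^ 2) a.
Proof.
intros hr h. set (m := 4 * r ^ 2) in *. assert (hm : 0 < m) by (unfold m; nra).
assert (h1 : adm c m (a + 1)) by (apply adm_mono with a; auto; lra).
assert (l1 := lam_decr c m a (a + 1) hm h ltac:(lra)).
assert (PI <= 4 * r * lam c m (a + 1)).
{ apply Rnot_lt_le. intros n.
  (* The cap 1 / 2 meets the requirement eps < 1 of [lam_asymptotic]. *)
  set (eps := Rmin (1 / 2) (PI - 4 * r * lam c m (a + 1))).
  assert (e1 := Rmin_l (1 / 2) (PI - 4 * r * lam c m (a + 1))).
  assert (e2 := Rmin_r (1 / 2) (PI - 4 * r * lam c m (a + 1))).
  destruct (lam_asymptotic c r eps (a + 2) hr) as (u & hu & hu' & l).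
  { split; [apply Rmin_glb_lt; lra | unfold eps; lra]. }
  fold m in l, hu'. assert (l2 := lam_decr c m (a + 1) u hm h1 ltac:(lra)).
  fold eps in e1, e2. nra. }
nra.
Qed.

(** * The lower bound D of lambda *)

Lemma pow3_lt (x y : R) : x < y -> x ^ 3 < y ^ 3.
Proof.
intros h. assert (0 < (y - x) * ((y - x) ^ 2 + 3 * (x + y) ^ 2)); [|lra].
assert (0 < (y - x) ^ 2) by (apply pow_lt; lra).
assert (p := pow2_ge_0 (x + y)). apply Rmult_lt_0_compat; lra.
Qed.

Lemma cbrt_unique (x y : R) : y ^ 3 = x -> cbrt x = y.
Proof.
intros h. assert (e := cbrt_pow3 x). rewrite <- h in e at 2.
destruct (Rtotal_order (cbrt x) y) as [l|[l|l]]; auto; apply pow3_lt in l; lra.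
Qed.

Lemma Rpower_two_thirds (r : R) : 0 < r -> Rpower (2 * r) (2 / 3) ^ 3 = 4 * r ^ 2.
Proof.
intros hr. rewrite <- Rpower_pow by apply exp_pos. rewrite Rpower_mult.
replace (2 / 3 * INR 3) with (INR 2) by (simpl; field).
rewrite Rpower_pow by lra. ring.
Qed.

Lemma cos_triple (x : R) : cos (3 * x) = 4 * cos x ^ 3 - 3 * cos x.
Proof.
replace (3 * x) with (2 * x + x) by ring. rewrite cos_plus, cos_2a, sin_2a.
assert (e := sin2_cos2 x). unfold Rsqr in e.
replace (sin x * sin x) with (1 - cos x * cos x) by lra.
replace (2 * sin x * cos x * sin x) with (2 * cos x * (1 - cos x * cos x))
  by (replace (1 - cos x * cos x) with (sin x * sin x) by lra; ring).
ring.
Qed.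

(* The critical parameter is a = s^2, and mu = 4 r / s - s^2 there. Cardano's
   radicands are the cubes of u + v and u - v for the u and v below. *)
Lemma D_above_eq (r s : R) : 0 < r -> 0 < s -> s ^ 3 <= 16 * r ->
  D_above r (4 * r / s - s ^ 2) = 4 * r * s - 4 * r ^ 2 / s ^ 2.
Proof.
intros hr hs h. unfold D_above.
set (X := sqrt (s * (16 * r - s ^ 3))).
assert (eX : X * X = s * (16 * r - s ^ 3)) by (apply sqrt_sqrt; nra).
assert (hX : 0 <= X) by apply sqrt_pos.
(* Here mu^3 + 108 r^2 = X^2 (s^3 + 2 r)^2 / s^4, so the root of its cube is rational in X, r and
   s. *)
assert (eM : sqrt (((4 * r / s - s ^ 2) ^ 3 + 108 * r ^ 2) ^ 3)
  = X * (s * (16 * r - s ^ 3)) * (s ^ 3 + 2 * r) ^ 3 / s ^ 6).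
{ rewrite <- eX.
  apply sqrt_lem_1.
  - apply pow_le. replace (_ + _) with (s * (16 * r - s ^ 3) * (s ^ 3 + 2 * r) ^ 2 / s ^ 4) by (field; lra).
    rewrite <- eX. apply Rmult_le_pos; [apply Rmult_le_pos; nra|].
    apply Rlt_le, Rinv_0_lt_compat, pow_lt, hs.
  - apply Rmult_le_pos; [apply Rmult_le_pos|].
    + nra.
    + apply pow_le. assert (0 < s ^ 3) by (apply pow_lt; auto). lra.
    + apply Rlt_le, Rinv_0_lt_compat, pow_lt, hs.
  - replace (X * (X * X) * (s ^ 3 + 2 * r) ^ 3 / s ^ 6 * (X * (X * X) * (s ^ 3 + 2 * r) ^ 3 / s ^ 6))
      with ((X * X) ^ 3 * (s ^ 3 + 2 * r) ^ 6 / s ^ 12) by (field; lra).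
    rewrite eX. field. lra. }
rewrite eM.
assert (e3 : sqrt 3 * sqrt 3 = 3) by (apply sqrt_sqrt; lra).
set (u := 16 * r ^ 2 / s ^ 2 - 20 * r * s - s ^ 4 / 2).
set (v := sqrt 3 / 2 * (16 * r - s ^ 3) * X / s).
assert (v2 : v * v = 3 / 4 * (16 * r - s ^ 3) ^ 3 / s).
{ unfold v. replace (_ * _) with ((sqrt 3 * sqrt 3) / 4 * (16 * r - s ^ 3) ^ 2 * (X * X) / s ^ 2) by (field; lra).
  rewrite e3, eX. field. lra. }
assert (eS : 48 * sqrt 3 * r * (X * (s * (16 * r - s ^ 3)) * (s ^ 3 + 2 * r) ^ 3 / s ^ 6)
  = v * (3 * u ^ 2 + v * v)).
{ rewrite v2. unfold u, v. field. lra. }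
assert (eP : (4 * r / s - s ^ 2) ^ 6 + 2160 * r ^ 2 * (4 * r / s - s ^ 2) ^ 3 - 93312 * r ^ 4
  = u * (u ^ 2 + 3 * (v * v))).
{ rewrite v2. unfold u. field. lra. }
rewrite eS, eP. rewrite (cbrt_unique _ (u + v)) by ring. rewrite (cbrt_unique _ (u - v)) by ring.
unfold u. field. lra.
Qed.

(** The irreducible case of Cardano: v becomes imaginary and Q = u^2 - v^2 is the squared modulus of
    u + v. With y = -u / sqrt(Q), the triple-angle formula identifies the given angle as pi - 3 acos
    y. *)
Lemma D_below_eq (r s : R) : 0 < r -> 0 < s -> 16 * r < s ^ 3 ->
  D_below r (4 * r / s - s ^ 2) = 4 * r * s - 4 * r ^ 2 / s ^ 2.
Proof.
intros hr hs h. unfold D_below.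
set (mu := 4 * r / s - s ^ 2).
set (u := 16 * r ^ 2 / s ^ 2 - 20 * r * s - s ^ 4 / 2).
set (Q := mu * (mu ^ 3 - 864 * r ^ 2)).
assert (hu : u < 0).
{ assert (e : u = - ((20 * r * s ^ 3 + s ^ 3 * s ^ 3 / 2 - 16 * r ^ 2) / s ^ 2)) by (unfold u; field; lra).
  rewrite e. apply Ropp_lt_gt_0_contravar. apply Rdiv_lt_0_compat; [nra|apply pow_lt; auto]. }
assert (hQ1 : Q - u ^ 2 = 3 / 4 * (s ^ 3 - 16 * r) ^ 3 / s) by (unfold Q, u, mu; field; lra).
assert (hQ2 : 4 * u ^ 2 - Q = 96 * r * (s ^ 3 + 2 * r) ^ 3 / s ^ 4) by (unfold Q, u, mu; field; lra).
assert (p1 : 0 < Q - u ^ 2).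
{ rewrite hQ1. apply Rdiv_lt_0_compat; auto. apply Rmult_lt_0_compat; [lra|]. apply pow_lt. lra. }
assert (p2 : 0 < 4 * u ^ 2 - Q).
{ rewrite hQ2. apply Rdiv_lt_0_compat; [|now apply pow_lt].
  apply Rmult_lt_0_compat; [lra|]. apply pow_lt. lra. }
assert (hQ : 0 < Q) by nra.
assert (sQ := sqrt_lt_R0 _ hQ). assert (qQ := sqrt_sqrt _ (Rlt_le _ _ hQ)).
set (q := sqrt Q) in *. set (y := - u / q).
assert (hy : y * q = - u) by (unfold y; field; lra).
assert (y1 : y <= 1).
{ apply Rnot_lt_le. intros n. assert (1 * q < y * q) by (apply Rmult_lt_compat_r; lra). nra. }
(* This gives acos y <= pi/3, so pi - 3 acos y lies in [0, pi] and [acos] inverts its cosine. *)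
assert (y2 : 1 / 2 <= y).
{ apply Rnot_lt_le. intros n. assert (y * q < 1 / 2 * q) by (apply Rmult_lt_compat_r; lra). nra. }
assert (b := acos_bound y). assert (cy : cos (acos y) = y) by (apply cos_acos; lra).
assert (b3 : acos y <= PI / 3).
{ apply Rnot_lt_le. intros n. apply cos_decreasing_1 in n; try lra; [|assert (p := PI_RGT_0); lra ..].
  rewrite cy, cos_PI3 in n. lra. }
assert (eP : - mu ^ 6 - 2160 * r ^ 2 * mu ^ 3 + 93312 * r ^ 4 = - (u * (4 * u ^ 2 - 3 * Q)))
  by (unfold u, Q, mu; field; lra).
assert (et : (- mu ^ 6 - 2160 * r ^ 2 * mu ^ 3 + 93312 * r ^ 4) / (mu * (864 * r ^ 2 - mu ^ 3) * q)
  = cos (PI - 3 * acos y)).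
{ rewrite Rtrigo_facts.cos_pi_minus, cos_triple, cy, eP.
  replace (mu * (864 * r ^ 2 - mu ^ 3)) with (- Q) by (unfold Q; ring).
  replace u with (- (y * q)) by lra. replace Q with (q * q). field. lra. }
rewrite et, acos_cos by lra.
replace ((PI - 3 * acos y - PI) / 3) with (- acos y) by field.
rewrite cos_neg, cy. replace (q / 6 * y) with (- u / 6) by lra.
unfold u, mu. field. lra.
Qed.

(** The value is [esq] - c^2 at the critical a = s^2. The threshold corresponds to s^3 = 16 r: its
    cube is -108 r^2, and mu^3 + 108 r^2 has the sign of 16 r - s^3. *)
Lemma D_bound_eq (r C1 s : R) : 0 < r -> 0 < s -> r ^ 2 * C1 = 4 * r / s - s ^ 2 ->
  D_bound r C1 = 4 * r * s - 4 * r ^ 2 / s ^ 2.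
Proof.
intros hr hs e. unfold D_bound. rewrite e.
assert (e3 := Rpower_two_thirds r hr). set (p := Rpower (2 * r) (2 / 3)) in *.
assert (eM : (4 * r / s - s ^ 2) ^ 3 - (- 3 * p) ^ 3 = (16 * r - s ^ 3) * ((s ^ 3 + 2 * r) ^ 2 / s ^ 3)).
{ replace ((- 3 * p) ^ 3) with (- 27 * p ^ 3) by ring. rewrite e3. field. lra. }
assert (hM : 0 < (s ^ 3 + 2 * r) ^ 2 / s ^ 3).
{ assert (0 < s ^ 3) by now apply pow_lt. apply Rdiv_lt_0_compat; auto. apply pow_lt. lra. }
destruct Rle_dec as [l|l].
- apply D_above_eq; auto. apply Rnot_lt_le. intros n.
  assert ((4 * r / s - s ^ 2) ^ 3 < (- 3 * p) ^ 3).
  { assert (0 < (s ^ 3 - 16 * r) * ((s ^ 3 + 2 * r) ^ 2 / s ^ 3)) by (apply Rmult_lt_0_compat; lra). lra. }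
  destruct l as [l|l]; [apply pow3_lt in l; lra|rewrite l in *; lra].
- apply D_below_eq; auto. apply Rnot_le_lt in l. apply Rnot_le_lt. intros n.
  apply pow3_lt in l.
  assert (0 <= (16 * r - s ^ 3) * ((s ^ 3 + 2 * r) ^ 2 / s ^ 3)) by (apply Rmult_le_pos; lra). lra.
Qed.

(** * The progression angle as a proper integral *)

Lemma bed_lt c m a x y : adm c m a -> 0 <= x <= PI -> 0 <= y <= PI ->
  bed c m a x < bed c m a y -> x < y.
Proof.
intros h hx hy. unfold bed. assert (k := hw_pos _ _ _ h). intros l.
apply cos_decreasing_0; try lra. apply Rmult_lt_reg_l with (hw c m a); lra.
Qed.

Lemma bed_onto c m a B : adm c m a ->
  c + a / 2 - hw c m a < B < c + a / 2 + hw c m a ->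
  exists t, 0 < t < PI /\ bed c m a t - a = B.
Proof.
intros h hB. assert (k := hw_pos _ _ _ h).
set (x := (c + a / 2 - B) / hw c m a).
assert (ex : x * hw c m a = c + a / 2 - B) by (unfold x; field; lra).
assert (hx : -1 < x < 1) by (split; apply Rmult_lt_reg_r with (hw c m a); lra).
exists (acos x). split; [now apply acos_bound_lt|].
unfold bed, tmid. rewrite cos_acos by lra. lra.
Qed.

(** By [chord_product] the radicand is [bed] (h sin t)^2 / (r^2 B). Its root absorbs both the
    Jacobian h sin t and B^(-1/2), so no singularity is left at the ends. *)
Lemma angle_integrand_bed r C1 C2 a t : 0 < r ->
  adm (r ^ 2 * C1 / 2) (4 * r ^ 2) a ->
  r ^ 2 * C2 = esq (r ^ 2 * C1 / 2) (4 * r ^ 2) a - (r ^ 2 * C1 / 2) ^ 2 ->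
  0 < t < PI ->
  continuous (angle_integrand r C1 C2) (bed (r ^ 2 * C1 / 2) (4 * r ^ 2) a t - a) /\
  hw (r ^ 2 * C1 / 2) (4 * r ^ 2) a * sin t
    * angle_integrand r C1 C2 (bed (r ^ 2 * C1 / 2) (4 * r ^ 2) a t - a)
  = r ^ 3 / sqrt (esq (r ^ 2 * C1 / 2) (4 * r ^ 2) a) * fint (r ^ 2 * C1 / 2) (4 * r ^ 2) a t.
Proof.
intros hr h e ht.
remember (r ^ 2 * C1 / 2) as c eqn:ec. remember (4 * r ^ 2) as m eqn:em.
assert (hm : 0 < m) by nra. assert (hr2 : 0 < r ^ 2) by nra.
assert (hD := den_pos c m a t hm h). assert (hb := bed_pos c m a t hm h).
assert (hE := esq_pos c m a hm h). assert (k := hw_pos _ _ _ h).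
assert (sb := sqrt_lt_R0 _ hb). assert (sE := sqrt_lt_R0 _ hE).
assert (hs : 0 < sin t) by (apply sin_gt_0; lra).
assert (cp := chord_product c m a t h).
set (B := bed c m a t - a) in *.
assert (hB : 0 < B).
{ assert (0 < B * den c m a t); [|nra]. rewrite cp.
  apply Rplus_lt_le_0_compat; auto. apply Rmult_le_pos; [lra|apply pow2_ge_0]. }
assert (eD : C2 - B ^ 2 / r ^ 2 + C1 * B = den c m a t / r ^ 2).
{ apply Rmult_eq_reg_l with (r ^ 2); [|lra].
  replace (r ^ 2 * (den c m a t / r ^ 2)) with (den c m a t) by (field; lra).
  replace (r ^ 2 * (C2 - B ^ 2 / r ^ 2 + C1 * B)) with (r ^ 2 * C2 - B ^ 2 + r ^ 2 * C1 * B) by (field; lra).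
  rewrite e. replace (r ^ 2 * C1) with (2 * c) by lra. unfold den, B, bed, zed, tmid. field. }
assert (eQ : C2 - B ^ 2 / r ^ 2 - 4 / B + C1 * B
  = bed c m a t * (hw c m a * sin t) ^ 2 / (r ^ 2 * B)).
{ replace (bed c m a t * (hw c m a * sin t) ^ 2) with (B * den c m a t - m) by lra.
  replace (C2 - B ^ 2 / r ^ 2 - 4 / B + C1 * B) with (den c m a t / r ^ 2 - 4 / B) by lra.
  rewrite em. field. lra. }
assert (hks : 0 < hw c m a * sin t) by now apply Rmult_lt_0_compat.
assert (hQ : 0 < bed c m a t * (hw c m a * sin t) ^ 2 / (r ^ 2 * B)).
{ apply Rdiv_lt_0_compat; apply Rmult_lt_0_compat; auto. now apply pow_lt. }
assert (sQ := sqrt_lt_R0 _ hQ).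
split.
- unfold angle_integrand, Rpower. apply @ex_derive_continuous.
  assert (r1 : C2 + - (B * (B * 1) * / r ^ 2) + C1 * B = den c m a t / r ^ 2)
    by (rewrite <- eD; field; lra).
  assert (r2 : C2 + - (B * (B * 1) * / r ^ 2) + - (4 * / B) + C1 * B
     = bed c m a t * (hw c m a * sin t) ^ 2 / (r ^ 2 * B))
    by (rewrite <- eQ; field; lra).
  assert (0 < den c m a t / r ^ 2) by now apply Rdiv_lt_0_compat.
  auto_derive. change (r * (r * 1)) with (r ^ 2). rewrite r1, r2.
  repeat split; auto; try lra. apply Rgt_not_eq. now apply Rmult_lt_0_compat.
- unfold angle_integrand, fint. rewrite eD, eQ.
  replace (- 1 / 2) with (- / 2) by field.
  rewrite Rpower_Ropp, Rpower_sqrt by auto.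
  assert (eS : sqrt B * sqrt (bed c m a t * (hw c m a * sin t) ^ 2 / (r ^ 2 * B))
    = sqrt (bed c m a t) * (hw c m a * sin t) / r).
  { rewrite <- sqrt_mult by lra.
    replace (B * (bed c m a t * (hw c m a * sin t) ^ 2 / (r ^ 2 * B)))
      with (bed c m a t * ((hw c m a * sin t) / r) ^ 2) by (field; lra).
    rewrite sqrt_mult by (try apply pow2_ge_0; lra).
    rewrite sqrt_pow2 by (apply Rlt_le, Rdiv_lt_0_compat; auto). field. lra. }
  assert (hSB := sqrt_lt_R0 _ hB).
  set (S := sqrt (_ / (r ^ 2 * B))) in *.
  transitivity (hw c m a * sin t * r ^ 2 / (den c m a t * (sqrt B * S))).
  { field. repeat split; lra. }
  rewrite eS. field. repeat split; lra.
Qed.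

Lemma is_RInt_angle r C1 C2 a x y : 0 < r ->
  adm (r ^ 2 * C1 / 2) (4 * r ^ 2) a ->
  r ^ 2 * C2 = esq (r ^ 2 * C1 / 2) (4 * r ^ 2) a - (r ^ 2 * C1 / 2) ^ 2 ->
  0 < x < PI -> 0 < y < PI ->
  is_RInt (angle_integrand r C1 C2)
    (bed (r ^ 2 * C1 / 2) (4 * r ^ 2) a x - a) (bed (r ^ 2 * C1 / 2) (4 * r ^ 2) a y - a)
    (r ^ 3 / sqrt (esq (r ^ 2 * C1 / 2) (4 * r ^ 2) a)
     * RInt (fint (r ^ 2 * C1 / 2) (4 * r ^ 2) a) x y).
Proof.
intros hr h e hx hy.
assert (hm : 0 < 4 * r ^ 2) by nra.
assert (k := hw_pos _ _ _ h).
assert (H := fun t => angle_integrand_bed r C1 C2 a t hr h e).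
set (c := r ^ 2 * C1 / 2) in *. set (m := 4 * r ^ 2) in *.
assert (hxy : forall t, Rmin x y <= t <= Rmax x y -> 0 < t < PI).
{ intros t. unfold Rmin, Rmax. destruct Rle_dec; lra. }
assert (ex : ex_RInt (angle_integrand r C1 C2) (bed c m a x - a) (bed c m a y - a)).
{ apply @ex_RInt_continuous. intros B hB.
  destruct (bed_onto c m a B h) as (t & ht & et).
  - assert (hb : forall t, 0 < t < PI ->
      c + a / 2 - hw c m a < bed c m a t - a < c + a / 2 + hw c m a).
    { intros t ht. unfold bed, tmid.
      assert (cos PI < cos t < cos 0) by (split; apply cos_decreasing_1; lra).
      rewrite cos_PI, cos_0 in *. nra. }
    assert (b1 := hb x hx). assert (b2 := hb y hy). revert hB.
    unfold Rmin, Rmax. destruct Rle_dec; lra.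
  - rewrite <- et. now apply H. }
apply (RInt_correct (V := R_CompleteNormedModule)) in ex.
assert (I := is_RInt_comp (angle_integrand r C1 C2) (fun t => bed c m a t - a)
  (fun t => hw c m a * sin t) x y).
assert (J : is_RInt (fun t => r ^ 3 / sqrt (esq c m a) * fint c m a t) x y
  (r ^ 3 / sqrt (esq c m a) * RInt (fint c m a) x y)).
{ apply (is_RInt_scal (fint c m a)). apply (RInt_correct (fint c m a)). now apply ex_RInt_fint. }
replace (_ * _) with (RInt (angle_integrand r C1 C2) (bed c m a x - a) (bed c m a y - a)); auto.
rewrite <- (is_RInt_unique (V := R_CompleteNormedModule) _ _ _ _ J). symmetry.
apply (is_RInt_unique (V := R_CompleteNormedModule)).
apply (is_RInt_ext (V := R_NormedModule) (fun t => scal (hw c m a * sin t) (angle_integrand r C1 C2 (bed c m a t - a)))).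
- intros t ht. apply H. apply hxy. lra.
- apply I.
  + intros t ht. now apply H, hxy.
  + intros t ht. split.
    * unfold bed. auto_derive; auto. ring.
    * apply @ex_derive_continuous. auto_derive. auto.
Qed.

(** The primitive F of [fint] is continuous also at 0 and pi. The integral between interior points
    is K (F y - F x), which converges as x tends to 0 and y to pi. *)
Lemma is_RInt_gen_angle r C1 C2 a : 0 < r ->
  adm (r ^ 2 * C1 / 2) (4 * r ^ 2) a ->
  r ^ 2 * C2 = esq (r ^ 2 * C1 / 2) (4 * r ^ 2) a - (r ^ 2 * C1 / 2) ^ 2 ->
  is_RInt_gen (angle_integrand r C1 C2)
    (at_right (r ^ 2 * C1 / 2 + a / 2 - hw (r ^ 2 * C1 / 2) (4 * r ^ 2) a))
    (at_left (r ^ 2 * C1 / 2 + a / 2 + hw (r ^ 2 * C1 / 2) (4 * r ^ 2) a))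
    (r ^ 3 / sqrt (esq (r ^ 2 * C1 / 2) (4 * r ^ 2) a) * lam (r ^ 2 * C1 / 2) (4 * r ^ 2) a).
Proof.
intros hr h e.
assert (hm : 0 < 4 * r ^ 2) by nra.
assert (k := hw_pos _ _ _ h).
assert (H := fun x y => is_RInt_angle r C1 C2 a x y hr h e).
set (c := r ^ 2 * C1 / 2) in *. set (m := 4 * r ^ 2) in *.
set (K := r ^ 3 / sqrt (esq c m a)) in *.
assert (hK : 0 < K).
{ apply Rdiv_lt_0_compat; [apply pow_lt; auto|]. apply sqrt_lt_R0. now apply esq_pos. }
set (F t := RInt (fint c m a) 0 t).
assert (cF : forall t, continuous F t).
{ intros t. apply @ex_derive_continuous. exists (fint c m a t).
  apply (is_derive_RInt (fint c m a) F 0 t).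
  - apply filter_forall. intros u. apply (RInt_correct (fint c m a)). now apply ex_RInt_fint.
  - apply @ex_derive_continuous. now apply ex_derive_fint_t. }
assert (eF : forall x y, RInt (fint c m a) x y = F y - F x).
{ intros x y. unfold F.
  assert (Ch := RInt_Chasles (V := R_CompleteNormedModule) (fint c m a) 0 x y
    (ex_RInt_fint _ _ _ _ _ hm h) (ex_RInt_fint _ _ _ _ _ hm h)).
  unfold plus in Ch. simpl in Ch. lra. }
assert (F0 : F 0 = 0) by (apply (RInt_point (V := R_CompleteNormedModule))).
assert (hpi := PI2_1).
intros P [eps hP].
assert (heps : 0 < eps / (2 * K)) by (apply Rdiv_lt_0_compat; [apply cond_pos|lra]).
destruct (cF 0 (ball (F 0) (eps / (2 * K)))) as [d0 h0]; [now exists (mkposreal _ heps)|].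
destruct (cF PI (ball (F PI) (eps / (2 * K)))) as [d1 h1]; [now exists (mkposreal _ heps)|].
(* The cap 1 keeps d and pi - d inside (0, pi). Points B close to the two ends then come from angles
   below d and above pi - d. *)
set (d := Rmin 1 (Rmin d0 d1)).
assert (hd : 0 < d) by (repeat apply Rmin_glb_lt; try apply cond_pos; lra).
assert (l1 := Rmin_l 1 (Rmin d0 d1)). assert (l2 := Rmin_r 1 (Rmin d0 d1)).
assert (l3 := Rmin_l d0 d1). assert (l4 := Rmin_r d0 d1). fold d in l1, l2.
assert (cd : -1 < cos d < 1).
{ split; [rewrite <- cos_PI|rewrite <- cos_0]; apply cos_decreasing_1; lra. }
exists (fun p => c + a / 2 - hw c m a < p < bed c m a d - a)
  (fun q => bed c m a (PI - d) - a < q < c + a / 2 + hw c m a).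
- assert (g : 0 < bed c m a d - a - (c + a / 2 - hw c m a)) by (unfold bed, tmid; nra).
  exists (mkposreal _ g). intros p hp lp. split; auto.
  apply Rabs_def2 in hp. simpl in hp. unfold minus, plus, opp in hp. simpl in hp. lra.
- assert (g : 0 < c + a / 2 + hw c m a - (bed c m a (PI - d) - a)).
  { unfold bed, tmid. rewrite Rtrigo_facts.cos_pi_minus. nra. }
  exists (mkposreal _ g). intros p hp lp. split; auto.
  apply Rabs_def2 in hp. simpl in hp. unfold minus, plus, opp in hp. simpl in hp. lra.
- intros p q hp hq. simpl.
  assert (hbd := bed_bounds c m a).
  destruct (bed_onto c m a p h) as (x & hx & ex).
  { assert (b := hbd d h). unfold tmid in b. lra. }
  destruct (bed_onto c m a q h) as (y & hy & ey).
  { assert (b := hbd (PI - d) h). unfold tmid in b. lra. }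
  exists (K * RInt (fint c m a) x y). split.
  + rewrite <- ex, <- ey. now apply H.
  + apply hP.
    assert (xd : x < d) by (apply (bed_lt c m a); auto; lra).
    assert (yd : PI - d < y) by (apply (bed_lt c m a); auto; lra).
    assert (b0 : Rabs (F x - F 0) < eps / (2 * K)).
    { apply h0. apply Rabs_def1; unfold minus, plus, opp; simpl; lra. }
    assert (b1 : Rabs (F y - F PI) < eps / (2 * K)).
    { apply h1. apply Rabs_def1; unfold minus, plus, opp; simpl; lra. }
    apply Rabs_def2 in b0. apply Rabs_def2 in b1.
    rewrite eF. change (lam c m a) with (F PI).
    change (Rabs (K * (F y - F x) - K * F PI) < eps).
    replace (K * (F y - F x) - K * F PI) with (K * ((F y - F PI) - (F x - F 0))) by (rewrite F0; ring).
    rewrite Rabs_mult, (Rabs_pos_eq K) by lra.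
    apply Rlt_le_trans with (K * (2 * (eps / (2 * K)))).
    * apply Rmult_lt_compat_l; auto. apply Rabs_def1; lra.
    * right. field. lra.
Qed.

Lemma progression_angle_param r C1 C2 a : 0 < r ->
  adm (r ^ 2 * C1 / 2) (4 * r ^ 2) a ->
  r ^ 2 * C2 = esq (r ^ 2 * C1 / 2) (4 * r ^ 2) a - (r ^ 2 * C1 / 2) ^ 2 ->
  (0 < root_A2 r C1 C2 < root_A1 r C1 C2 /\
   cubic r C1 C2 (root_A1 r C1 C2) = 0 /\
   cubic r C1 C2 (root_A2 r C1 C2) = 0 /\
   ex_RInt_gen (angle_integrand r C1 C2)
     (at_right (root_A2 r C1 C2)) (at_left (root_A1 r C1 C2))) /\
  progression_angle r C1 C2 = 4 * r * lam (r ^ 2 * C1 / 2) (4 * r ^ 2) a.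
Proof.
intros hr h e. assert (I := is_RInt_gen_angle r C1 C2 a hr h e).
assert (hm : 0 < 4 * r ^ 2) by nra. assert (hr2 : 0 < r ^ 2) by nra.
assert (k := hw_pos _ _ _ h). assert (k2 := hw_lt _ _ _ hm h). assert (k3 := hw_sq _ _ _ h).
assert (hE := esq_pos _ _ _ hm h). assert (sE := sqrt_lt_R0 _ hE).
assert (ha := proj1 h).
assert (eC2 : C2 = (esq (r ^ 2 * C1 / 2) (4 * r ^ 2) a - (r ^ 2 * C1 / 2) ^ 2) / r ^ 2)
  by (rewrite <- e; field; lra).
assert (root : forall x, (x - (r ^ 2 * C1 / 2 + a / 2)) ^ 2 = hw (r ^ 2 * C1 / 2) (4 * r ^ 2) a ^ 2 ->
  cubic r C1 C2 x = 0).
{ intros x hx. rewrite k3 in hx. unfold hsq in hx.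
  (* The cubic factors through its negative root -a and the pair of positive roots. *)
  transitivity (((x - (r ^ 2 * C1 / 2 + a / 2)) ^ 2
     - ((r ^ 2 * C1 / 2 + a / 2) ^ 2 - 4 * r ^ 2 / a)) * (x + a) / r ^ 2).
  - unfold cubic. rewrite eC2. unfold esq. field. lra.
  - rewrite hx. field. lra. }
set (c := r ^ 2 * C1 / 2) in *. set (m := 4 * r ^ 2) in *.
destruct (root_A1_A2 r C1 C2 (c + a / 2 + hw c m a) (c + a / 2 - hw c m a) hr) as [e1 e2].
- lra.
- apply root. ring.
- apply root. ring.
- rewrite e1, e2. split.
  + repeat split; try lra; try (apply root; ring). eexists. exact I.
  + unfold progression_angle. rewrite e1, e2, (is_RInt_gen_unique _ _ I).
    (* The prefactor contains the root of 4 [esq] / r^4, which cancels the 1 / sqrt([esq]) produced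
       by the substitution. *)
    replace (4 * C2 / r ^ 2 + C1 ^ 2) with (esq c m a * (2 / r ^ 2) ^ 2).
    2:{ rewrite eC2. unfold c. field. lra. }
    assert (0 < 2 / r ^ 2) by (apply Rdiv_lt_0_compat; lra).
    rewrite sqrt_mult by (try apply pow2_ge_0; lra). rewrite sqrt_pow2 by lra.
    field. split; lra.
Qed.

(** * The critical parameter s and the correspondence between lambda and a *)

(** Here s is a positive root of s^3 + mu s - 4 r; at a = s^2 the positive roots merge at 2 r / s.
    The existence is informative so that the main proof can take s as a function of C1. *)
Lemma critical_parameter (r mu : R) : 0 < r -> {s | 0 < s /\ mu = 4 * r / s - s ^ 2}.
Proof.
intros hr. set (f s := s ^ 3 + mu * s - 4 * r). set (S := 1 + Rabs mu + 4 * r).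
assert (p := Rabs_pos mu). assert (p' := Rle_abs (- mu)). rewrite Rabs_Ropp in p'.
destruct (IVT f 0 S) as (s & hs & e).
- intros x. apply derivable_continuous_pt. unfold f. reg.
- unfold S. lra.
- unfold f. lra.
- unfold f. assert (S * (S * 1) <= S * (S * S - Rabs mu)).
  { apply Rmult_le_compat_l; [unfold S; lra|].
    assert (S * (1 + Rabs mu) <= S * S) by (apply Rmult_le_compat_l; unfold S; lra).
    assert (1 * Rabs mu <= S * Rabs mu) by (apply Rmult_le_compat_r; unfold S; lra). lra. }
  assert (0 <= S * (mu + Rabs mu)) by (apply Rmult_le_pos; unfold S; lra).
  assert (4 * r * 1 < S * S) by (apply Rmult_ge_0_gt_0_lt_compat; unfold S; lra). lra.
- exists s. unfold f in e. destruct (Req_EM_T s 0) as [z|z].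
  + exfalso. rewrite z in e. lra.
  + split; [lra|]. apply Rmult_eq_reg_l with s; auto.
    replace (s * (4 * r / s - s ^ 2)) with (4 * r - s ^ 3) by (field; auto). lra.
Qed.

(** At a = s^2 one has c + a / 2 = 2 r / s, and the last condition of [adm] is an equality; it
    becomes strict beyond. *)
Lemma adm_critical (r c s a : R) : 0 < r -> 0 < s -> 2 * c = 4 * r / s - s ^ 2 ->
  s ^ 2 < a -> adm c (4 * r ^ 2) a.
Proof.
intros hr hs e ha. assert (h1 : 0 < r / s) by now apply Rdiv_lt_0_compat.
assert (h2 : 0 < s ^ 2) by now apply pow_lt.
assert (h3 : 2 * (r / s) < c + a / 2) by (unfold Rdiv in *; lra).
repeat split; try lra.
replace (4 * r ^ 2) with (s ^ 2 * (2 * (r / s)) ^ 2) by (field; lra).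
apply Rmult_gt_0_lt_compat; try lra.
- apply pow_lt. lra.
- assert (0 < (c + a / 2 - 2 * (r / s)) * (c + a / 2 + 2 * (r / s)))
    by (apply Rmult_lt_0_compat; lra). lra.
Qed.

Lemma esq_incr c m a u : 0 < m -> adm c m a -> adm c m u -> a < u -> esq c m a < esq c m u.
Proof.
intros hm (h1 & h2 & h3) (k1 & k2 & k3) h. unfold esq.
assert (m / u < m / a).
{ apply Rmult_lt_compat_l; auto. apply Rinv_lt_contravar; auto. nra. }
assert (0 < (u - a) * (2 * c + a + u)) by (apply Rmult_lt_0_compat; lra). lra.
Qed.

Lemma esq_onto (r c s l : R) : 0 < r -> 0 < s -> 2 * c = 4 * r / s - s ^ 2 ->
  4 * r * s - 4 * r ^ 2 / s ^ 2 < l ->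
  exists a, s ^ 2 < a /\ l = esq c (4 * r ^ 2) a - c ^ 2.
Proof.
intros hr hs e hl. set (m := 4 * r ^ 2). assert (hm : 0 < m) by (unfold m; nra).
(* For l = r^2 C2 this is -r^2 times the cubic at -x. At s^2 it equals s^2 times the critical value
   minus l, hence is negative. *)
set (f x := x ^ 3 + 2 * c * x ^ 2 - l * x - m).
set (U := 1 + 2 * Rabs c + Rabs l + m + s ^ 2).
assert (p := Rabs_pos c). assert (p' := Rle_abs (- c)). rewrite Rabs_Ropp in p'.
assert (q := Rabs_pos l). assert (q' := Rle_abs l).
assert (hs2 : 0 < s ^ 2) by now apply pow_lt.
assert (f0 : f (s ^ 2) < 0).
{ replace (f (s ^ 2)) with (s ^ 2 * ((4 * r * s - 4 * r ^ 2 / s ^ 2) - l)).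
  - assert (0 < s ^ 2 * (l - (4 * r * s - 4 * r ^ 2 / s ^ 2))) by (apply Rmult_lt_0_compat; lra). lra.
  - unfold f, m. rewrite e. field. lra. }
assert (f1 : 0 < f U).
{ unfold f.
  assert (hU : 1 <= U) by (unfold U; lra).
  assert (U * U * (1 + Rabs l + m) <= U * U * (U + 2 * c)) by
    (apply Rmult_le_compat_l; [nra|unfold U; lra]).
  assert (U * 1 * (Rabs l) <= U * U * Rabs l) by
    (apply Rmult_le_compat_r; [|apply Rmult_le_compat_l]; lra).
  assert (U * l <= U * Rabs l) by (apply Rmult_le_compat_l; lra).
  assert (1 * m <= U * U * m) by (apply Rmult_le_compat_r; nra). nra. }
destruct (IVT f (s ^ 2) U) as (a & ha & e0); auto.
- intros x. apply derivable_continuous_pt. unfold f. reg.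
- unfold U. lra.
- exists a. destruct ha as [[ha|ha] _].
  + split; auto. unfold f in e0. unfold esq. apply Rmult_eq_reg_l with a; [|lra].
    replace (a * ((c + a) ^ 2 - m / a - c ^ 2)) with (a ^ 3 + 2 * c * a ^ 2 - m) by (field; lra). lra.
  + exfalso. rewrite ha in f0. lra.
Qed.

(** * The limit at D *)

(** The value of 4 r pi [fint] at a = s^2, where h = 0 and [fint] no longer depends on t. *)
Definition angle_limit (r s : R) : R := PI * sqrt ((s ^ 3 + 8 * r) / (s ^ 3 + 2 * r)).

(** A squeeze: replacing [den] and [bed] by their constant bounds gives [lo] and [hi], which are
    continuous at s^2 and agree there because h = 0. *)
Lemma lam_limit (r c s : R) (eps : posreal) :
  0 < r -> 0 < s -> 2 * c = 4 * r / s - s ^ 2 ->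
  exists d, 0 < d /\ forall a, s ^ 2 < a < s ^ 2 + d ->
    Rabs (4 * r * lam c (4 * r ^ 2) a - angle_limit r s) < eps.
Proof.
intros hr hs e. set (m := 4 * r ^ 2). assert (hm : 0 < m) by (unfold m; nra).
set (lo a := 4 * r * (PI * (sqrt (esq c m a)
  / ((hw c m a ^ 2 + a * (tmid c a - a + hw c m a)) * sqrt (tmid c a + hw c m a))))).
set (hi a := 4 * r * (PI * (sqrt (esq c m a)
  / ((a * (tmid c a - a - hw c m a)) * sqrt (tmid c a - hw c m a))))).
assert (bnd : forall a, s ^ 2 < a -> lo a <= 4 * r * lam c m a <= hi a).
{ intros a ha. assert (h := adm_critical r c s a hr hs e ha). fold m in h.
  assert (hE := esq_pos _ _ _ hm h). assert (sE := sqrt_lt_R0 _ hE).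
  assert (k := hw_pos _ _ _ h). assert (k2 := hw_lt _ _ _ hm h).
  assert (ha0 := proj1 h). assert (hpi := PI_RGT_0).
  assert (cI : forall v, is_RInt (fun _ => v) 0 PI (PI * v)).
  { intros v. assert (J := is_RInt_const (V := R_NormedModule) 0 PI v).
    unfold scal in J. simpl in J. unfold mult in J. simpl in J. now rewrite Rminus_0_r in J. }
  assert (I := RInt_correct (fint c m a) 0 PI (ex_RInt_fint c m a 0 PI hm h)).
  assert (0 < a * (tmid c a - a - hw c m a)) by (apply Rmult_lt_0_compat; unfold tmid; lra).
  assert (0 < sqrt (tmid c a - hw c m a)) by (apply sqrt_lt_R0; unfold tmid; lra).
  split; (apply Rmult_le_compat_l; [lra|]).
  - apply (is_RInt_le _ _ 0 PI _ _ (Rlt_le _ _ hpi) (cI _) I). intros t _. unfold fint.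
    assert (hD := den_pos c m a t hm h). assert (hb := bed_pos c m a t hm h).
    assert (sb := sqrt_lt_R0 _ hb).
    apply Rmult_le_compat_l; [lra|]. apply Rinv_le_contravar; [now apply Rmult_lt_0_compat|].
    apply Rmult_le_compat; try lra; [apply den_bounds | apply sqrt_le_1_alt, bed_bounds]; auto.
  - apply (is_RInt_le _ _ 0 PI _ _ (Rlt_le _ _ hpi) I (cI _)). intros t _. unfold fint.
    assert (hD := den_pos c m a t hm h).
    apply Rmult_le_compat_l; [lra|]. apply Rinv_le_contravar; [now apply Rmult_lt_0_compat|].
    apply Rmult_le_compat; try lra; [apply den_bounds | apply sqrt_le_1_alt, bed_bounds]; auto. }
assert (hs2 : 0 < s ^ 2) by now apply pow_lt.
assert (hs3 : 0 < s ^ 3) by now apply pow_lt.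
assert (ec : c = (4 * r / s - s ^ 2) / 2) by lra.
assert (h0 : hw c m (s ^ 2) = 0).
{ unfold hw. replace (hsq c m (s ^ 2)) with 0; [apply sqrt_0|].
  unfold hsq, m. rewrite ec. field. lra. }
assert (hrs : 0 < r / s) by now apply Rdiv_lt_0_compat.
assert (eT : tmid c (s ^ 2) = 2 * (r / s) + s ^ 2) by (unfold tmid; rewrite ec; field; lra).
assert (eE : esq c m (s ^ 2) = s / 4 * (s ^ 3 + 8 * r)).
{ unfold esq, m. rewrite ec. field. lra. }
assert (val : 4 * r * (PI * (sqrt (esq c m (s ^ 2))
  / ((s ^ 2 * (tmid c (s ^ 2) - s ^ 2)) * sqrt (tmid c (s ^ 2))))) = angle_limit r s).
{ assert (hT : 0 < tmid c (s ^ 2)) by lra. assert (sT := sqrt_lt_R0 _ hT).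
  assert (qT := sqrt_sqrt _ (Rlt_le _ _ hT)).
  assert (hE : 0 < esq c m (s ^ 2)) by (rewrite eE; apply Rmult_lt_0_compat; lra).
  assert (qE := sqrt_sqrt _ (Rlt_le _ _ hE)).
  unfold angle_limit.
  rewrite (sqrt_lem_1 ((s ^ 3 + 8 * r) / (s ^ 3 + 2 * r))
    (2 * sqrt (esq c m (s ^ 2)) / (s * sqrt (tmid c (s ^ 2))))).
  - set (q := sqrt (tmid c (s ^ 2))) in *. rewrite eT.
    replace (2 * (r / s) + s ^ 2 - s ^ 2) with (2 * (r / s)) by ring. field. repeat split; lra.
  - apply Rlt_le, Rdiv_lt_0_compat; lra.
  - apply Rlt_le, Rdiv_lt_0_compat; [apply Rmult_lt_0_compat; [lra|now apply sqrt_lt_R0]|].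
    now apply Rmult_lt_0_compat.
  - set (q := sqrt (tmid c (s ^ 2))) in *. set (x := sqrt (esq c m (s ^ 2))) in *.
    replace (2 * x / (s * q) * (2 * x / (s * q))) with (4 * (x * x) / (s ^ 2 * (q * q))) by (field; lra).
    rewrite qT, qE, eT, eE. field. lra. }
assert (cw : continuity_2d_pt (fun u _ => hw c m u) (s ^ 2) 0).
{ apply continuity_2d_fst, continuity_pt_filterlim. unfold hw.
  apply (continuous_sqrt_comp (hsq c m)). apply @ex_derive_continuous.
  unfold hsq. auto_derive. lra. }
assert (ce : continuity_2d_pt (fun u _ => sqrt (esq c m u)) (s ^ 2) 0).
{ apply (continuity_2d_fst (fun u => sqrt (esq c m u))), continuity_pt_filterlim.
  apply (continuous_sqrt_comp (esq c m)). apply @ex_derive_continuous.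
  unfold esq. auto_derive. lra. }
assert (ct : continuity_2d_pt (fun u _ => tmid c u) (s ^ 2) 0).
{ apply continuity_2d_fst, continuity_pt_filterlim. apply @ex_derive_continuous.
  unfold tmid. auto_derive. auto. }
assert (ci := continuity_2d_pt_id1 (s ^ 2) 0).
assert (sT : 0 < sqrt (tmid c (s ^ 2))) by (apply sqrt_lt_R0; lra).
assert (clo : continuity_2d_pt (fun u _ => lo u) (s ^ 2) 0).
{ unfold lo.
  repeat first [ assumption | apply continuity_2d_pt_const | apply continuity_2d_sqrt
  | apply continuity_2d_sq | apply continuity_2d_pt_minus | apply continuity_2d_pt_plus
  | apply continuity_2d_div | apply continuity_2d_pt_mult ];
  rewrite h0, ?Rplus_0_r; [|lra].
  apply Rgt_not_eq. apply Rmult_lt_0_compat; auto.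
  replace (0 ^ 2) with 0 by ring. rewrite Rplus_0_l. apply Rmult_lt_0_compat; lra. }
assert (chi : continuity_2d_pt (fun u _ => hi u) (s ^ 2) 0).
{ unfold hi.
  repeat first [ assumption | apply continuity_2d_pt_const | apply continuity_2d_sqrt
  | apply continuity_2d_sq | apply continuity_2d_pt_minus | apply continuity_2d_pt_plus
  | apply continuity_2d_div | apply continuity_2d_pt_mult ];
  rewrite h0, ?Rminus_0_r; [|lra].
  apply Rgt_not_eq. apply Rmult_lt_0_compat; auto. apply Rmult_lt_0_compat; lra. }
assert (vlo : lo (s ^ 2) = angle_limit r s).
{ rewrite <- val. unfold lo. rewrite h0, !Rplus_0_r. replace (0 ^ 2) with 0 by ring.
  now rewrite Rplus_0_l. }
assert (vhi : hi (s ^ 2) = angle_limit r s).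
{ rewrite <- val. unfold hi. now rewrite h0, !Rminus_0_r. }
destruct (clo eps) as [d1 h1]. destruct (chi eps) as [d2 h2].
exists (Rmin d1 d2). split; [apply Rmin_glb_lt; apply cond_pos|].
intros a ha. assert (m1 := Rmin_l d1 d2). assert (m2 := Rmin_r d1 d2).
specialize (h1 a 0). specialize (h2 a 0). rewrite vlo in h1. rewrite vhi in h2.
rewrite Rminus_0_r, Rabs_R0, (Rabs_pos_eq (a - s ^ 2)) in h1, h2 by lra.
assert (k1 := h1 ltac:(lra) (cond_pos _)). assert (k2 := h2 ltac:(lra) (cond_pos _)).
apply Rabs_def2 in k1. apply Rabs_def2 in k2.
assert (b := bnd a ltac:(lra)). apply Rabs_def1; lra.
Qed.

(** * Monotonicity and bounds of the limit value as a function of s *)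

Lemma angle_limit_decr (r s s' : R) : 0 < r -> 0 < s -> s < s' -> angle_limit r s' < angle_limit r s.
Proof.
intros hr hs h. assert (h1 := pow3_lt _ _ h). assert (h0 : 0 < s ^ 3) by now apply pow_lt.
unfold angle_limit. apply Rmult_lt_compat_l; [apply PI_RGT_0|]. apply sqrt_lt_1_alt. split.
- apply Rlt_le, Rdiv_lt_0_compat; lra.
- apply Rmult_lt_reg_r with ((s' ^ 3 + 2 * r) * (s ^ 3 + 2 * r)); [apply Rmult_lt_0_compat; lra|].
  replace ((s' ^ 3 + 8 * r) / (s' ^ 3 + 2 * r) * ((s' ^ 3 + 2 * r) * (s ^ 3 + 2 * r)))
    with ((s' ^ 3 + 8 * r) * (s ^ 3 + 2 * r)) by (field; lra).
  replace ((s ^ 3 + 8 * r) / (s ^ 3 + 2 * r) * ((s' ^ 3 + 2 * r) * (s ^ 3 + 2 * r)))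
    with ((s ^ 3 + 8 * r) * (s' ^ 3 + 2 * r)) by (field; lra).
  assert (0 < r * (s' ^ 3 - s ^ 3)) by (apply Rmult_lt_0_compat; lra). lra.
Qed.

(** From sqrt (1 + 2 x) <= 1 + x with x = 3 r / s^3; it governs large s, that is C1 tending to minus
    infinity. *)
Lemma angle_limit_ub (r s : R) : 0 < r -> 0 < s ->
  angle_limit r s <= PI * (1 + 3 * r / s ^ 3).
Proof.
intros hr hs. assert (h0 : 0 < s ^ 3) by now apply pow_lt.
unfold angle_limit. apply Rmult_le_compat_l; [apply Rlt_le, PI_RGT_0|].
assert (h1 : 0 < 3 * r / s ^ 3) by (apply Rdiv_lt_0_compat; lra).
rewrite <- (sqrt_pow2 (1 + 3 * r / s ^ 3)) by lra. apply sqrt_le_1_alt.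
replace ((s ^ 3 + 8 * r) / (s ^ 3 + 2 * r)) with (1 + 6 * r / (s ^ 3 + 2 * r)) by (field; lra).
assert (6 * r / (s ^ 3 + 2 * r) <= 6 * r / s ^ 3).
{ apply Rmult_le_compat_l; [lra|]. apply Rinv_le_contravar; lra. }
assert (6 * r / s ^ 3 = 2 * (3 * r / s ^ 3)) by (field; lra). nra.
Qed.

(** The ratio is 4 - y with 0 < y <= 3, and (4 - y) - (2 - y)^2 = y (3 - y) >= 0. The bound governs
    small s, that is C1 tending to plus infinity. *)
Lemma angle_limit_lb (r s : R) : 0 < r -> 0 < s ->
  PI * (2 - 3 * s ^ 3 / (2 * r)) <= angle_limit r s.
Proof.
intros hr hs. assert (h0 : 0 < s ^ 3) by now apply pow_lt.
unfold angle_limit. apply Rmult_le_compat_l; [apply Rlt_le, PI_RGT_0|].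
set (y := 3 * s ^ 3 / (s ^ 3 + 2 * r)).
assert (hy : 0 < y) by (apply Rdiv_lt_0_compat; lra).
assert (hy2 : y <= 3).
{ apply Rmult_le_reg_r with (s ^ 3 + 2 * r); [lra|].
  replace (y * (s ^ 3 + 2 * r)) with (3 * s ^ 3) by (unfold y; field; lra). lra. }
apply Rle_trans with (2 - y).
- assert (y <= 3 * s ^ 3 / (2 * r)); [|lra].
  apply Rmult_le_compat_l; [lra|]. apply Rinv_le_contravar; lra.
- replace ((s ^ 3 + 8 * r) / (s ^ 3 + 2 * r)) with (4 - y) by (unfold y; field; lra).
  apply Rsqr_incr_0_var; [|apply sqrt_pos]. rewrite Rsqr_sqrt by lra. unfold Rsqr.
  assert (0 <= y * (3 - y)) by (apply Rmult_le_pos; lra). lra.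
Qed.

Lemma angle_limit_lt_2PI (r s : R) : 0 < r -> 0 < s -> angle_limit r s < 2 * PI.
Proof.
intros hr hs. assert (h0 : 0 < s ^ 3) by now apply pow_lt.
unfold angle_limit. rewrite Rmult_comm. apply Rmult_lt_compat_r; [apply PI_RGT_0|].
apply Rlt_le_trans with (sqrt (2 ^ 2)); [|right; apply sqrt_pow2; lra].
apply sqrt_lt_1_alt. split.
- apply Rlt_le, Rdiv_lt_0_compat; lra.
- apply Rmult_lt_reg_r with (s ^ 3 + 2 * r); [lra|].
  replace ((s ^ 3 + 8 * r) / (s ^ 3 + 2 * r) * (s ^ 3 + 2 * r)) with (s ^ 3 + 8 * r) by (field; lra).
  lra.
Qed.

Lemma angle_limit_gt_PI (r s : R) : 0 < r -> 0 < s -> PI < angle_limit r s.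
Proof.
intros hr hs. assert (h0 : 0 < s ^ 3) by now apply pow_lt.
unfold angle_limit. rewrite <- (Rmult_1_r PI) at 1. apply Rmult_lt_compat_l; [apply PI_RGT_0|].
rewrite <- sqrt_1 at 1. apply sqrt_lt_1_alt. split; [lra|].
apply Rmult_lt_reg_r with (s ^ 3 + 2 * r); [lra|].
replace ((s ^ 3 + 8 * r) / (s ^ 3 + 2 * r) * (s ^ 3 + 2 * r)) with (s ^ 3 + 8 * r) by (field; lra).
lra.
Qed.

Lemma critical_decr (r s s' : R) : 0 < r -> 0 < s -> 0 < s' ->
  4 * r / s - s ^ 2 < 4 * r / s' - s' ^ 2 -> s' < s.
Proof.
intros hr hs hs' h. apply Rnot_le_lt. intros n.
assert (4 * r / s' <= 4 * r / s).
{ apply Rmult_le_compat_l; [lra|]. now apply Rinv_le_contravar. }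
assert (s ^ 2 <= s' ^ 2) by (apply pow_incr; lra). lra.
Qed.

(** * The angle as a function of C1 and C2 *)

Lemma angle_above_bound r C1 s : 0 < r -> 0 < s -> r ^ 2 * C1 = 4 * r / s - s ^ 2 ->
  forall C2, D_bound r C1 < r ^ 2 * C2 ->
  exists a, s ^ 2 < a /\ adm (r ^ 2 * C1 / 2) (4 * r ^ 2) a /\
    r ^ 2 * C2 = esq (r ^ 2 * C1 / 2) (4 * r ^ 2) a - (r ^ 2 * C1 / 2) ^ 2.
Proof.
intros hr hs e C2 h. rewrite (D_bound_eq r C1 s hr hs e) in h.
assert (e' : 2 * (r ^ 2 * C1 / 2) = 4 * r / s - s ^ 2) by lra.
destruct (esq_onto r (r ^ 2 * C1 / 2) s (r ^ 2 * C2) hr hs e' h) as (a & ha & ea).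
exists a. split; [|split]; auto. now apply (adm_critical r _ s).
Qed.

Lemma filterlim_progression_angle r C1 s : 0 < r -> 0 < s ->
  r ^ 2 * C1 = 4 * r / s - s ^ 2 ->
  filterlim (fun l => progression_angle r C1 (l / r ^ 2))
    (at_right (D_bound r C1)) (locally (angle_limit r s)).
Proof.
intros hr hs e. apply filterlim_locally. intros eps.
assert (e' : 2 * (r ^ 2 * C1 / 2) = 4 * r / s - s ^ 2) by lra.
assert (hm : 0 < 4 * r ^ 2) by nra. assert (hr2 : 0 < r ^ 2) by nra.
assert (hs2 : 0 < s ^ 2) by now apply pow_lt.
destruct (lam_limit r (r ^ 2 * C1 / 2) s eps hr hs e') as (d & hd & hlim).
set (c := r ^ 2 * C1 / 2) in *. set (m := 4 * r ^ 2) in *.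
assert (h1 : adm c m (s ^ 2 + d)) by (apply (adm_critical r c s); auto; lra).
assert (h2 : adm c m (s ^ 2 + d / 2)) by (apply (adm_critical r c s); auto; lra).
assert (i := esq_incr c m _ _ hm h2 h1 ltac:(lra)).
(* The point s^2 is not admissible, so [esq_incr] does not apply from there and the increment of
   lambda up to s^2 + d is computed directly. Monotonicity beyond it shows that lambda within this
   gap of D forces a < s^2 + d. *)
assert (g : 0 < esq c m (s ^ 2 + d) - c ^ 2 - D_bound r C1).
{ rewrite (D_bound_eq r C1 s hr hs e).
  replace (4 * r * s - 4 * r ^ 2 / s ^ 2) with (esq c m (s ^ 2) - c ^ 2).
  2:{ unfold esq, m. replace c with ((4 * r / s - s ^ 2) / 2) by lra. field. lra. }
  unfold esq. assert (m / (s ^ 2 + d) < m / s ^ 2).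
  { apply Rmult_lt_compat_l; auto. apply Rinv_lt_contravar; [|lra]. apply Rmult_lt_0_compat; lra. }
  assert (0 < 4 * r / s) by (apply Rdiv_lt_0_compat; lra).
  assert (0 < d * (2 * c + 2 * s ^ 2 + d)) by (apply Rmult_lt_0_compat; lra). lra. }
remember (esq c m (s ^ 2 + d) - c ^ 2 - D_bound r C1) as gap eqn:eg.
exists (mkposreal _ g). intros l hl hl'.
apply Rabs_def2 in hl. simpl in hl. unfold minus, plus, opp in hl. simpl in hl.
assert (el : r ^ 2 * (l / r ^ 2) = l) by (field; lra).
destruct (angle_above_bound r C1 s hr hs e (l / r ^ 2)) as (a & ha & h & ea); [lra|].
rewrite (proj2 (progression_angle_param r C1 (l / r ^ 2) a hr h ea)).
apply hlim. split; auto. apply Rnot_le_lt. intros [n|n].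
- assert (j := esq_incr _ _ _ _ hm h1 h n). fold c m in ea. lra.
- fold c m in ea. rewrite <- n in ea. lra.
Qed.

Lemma progression_angle_decr r C1 C2 C2' : 0 < r ->
  D_bound r C1 < r ^ 2 * C2 -> D_bound r C1 < r ^ 2 * C2' -> C2 < C2' ->
  progression_angle r C1 C2' < progression_angle r C1 C2.
Proof.
intros hr h h' l. destruct (critical_parameter r (r ^ 2 * C1) hr) as (s & hs & e).
assert (hm : 0 < 4 * r ^ 2) by nra. assert (hr2 : 0 < r ^ 2) by nra.
destruct (angle_above_bound r C1 s hr hs e C2 h) as (a & ha & had & ea).
destruct (angle_above_bound r C1 s hr hs e C2' h') as (a' & ha' & had' & ea').
rewrite (proj2 (progression_angle_param r C1 _ a hr had ea)).
rewrite (proj2 (progression_angle_param r C1 _ a' hr had' ea')).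
apply Rmult_lt_compat_l; [lra|]. apply lam_decr; auto.
assert (r ^ 2 * C2 < r ^ 2 * C2') by (apply Rmult_lt_compat_l; lra).
apply Rnot_le_lt. intros [n|n].
- assert (j := esq_incr _ _ _ _ hm had' had n). lra.
- subst a'. lra.
Qed.

(** For the upper bound an intermediate lambda gives strictness. An angle there above the limit
    would be exceeded by every angle closer to D, contradicting convergence. *)
Lemma progression_angle_bounds r C1 C2 s : 0 < r -> 0 < s ->
  r ^ 2 * C1 = 4 * r / s - s ^ 2 -> D_bound r C1 < r ^ 2 * C2 ->
  PI < progression_angle r C1 C2 < angle_limit r s.
Proof.
intros hr hs e h. assert (hr2 : 0 < r ^ 2) by nra. split.
- destruct (angle_above_bound r C1 s hr hs e C2 h) as (a & ha & had & ea).
  rewrite (proj2 (progression_angle_param r C1 _ a hr had ea)). now apply lam_gt_PI.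
- set (l := (D_bound r C1 + r ^ 2 * C2) / 2).
  assert (el : r ^ 2 * (l / r ^ 2) = l) by (field; lra).
  apply Rlt_le_trans with (progression_angle r C1 (l / r ^ 2)).
  + apply progression_angle_decr; auto; [unfold l in *; lra|].
    apply Rmult_lt_reg_l with (r ^ 2); auto. unfold l in *. lra.
  + apply Rnot_lt_le. intros n.
    assert (F := filterlim_progression_angle r C1 s hr hs e).
    destruct (proj1 (filterlim_locally _ _) F (mkposreal _ (proj2 (Rlt_0_minus _ _) n))) as [d hd].
    (* This l' lies within d of D and strictly between D and l. *)
    set (l' := D_bound r C1 + Rmin (d / 2) ((l - D_bound r C1) / 2)).
    assert (hl : 0 < l - D_bound r C1) by (unfold l; lra).
    assert (hd' := cond_pos d).
    assert (q1 := Rmin_l (d / 2) ((l - D_bound r C1) / 2)).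
    assert (q2 := Rmin_r (d / 2) ((l - D_bound r C1) / 2)).
    assert (q3 : 0 < Rmin (d / 2) ((l - D_bound r C1) / 2)) by (apply Rmin_glb_lt; lra).
    assert (el' : r ^ 2 * (l' / r ^ 2) = l') by (field; lra).
    assert (b := hd l').
    assert (b' : Rabs (progression_angle r C1 (l' / r ^ 2) - angle_limit r s)
      < progression_angle r C1 (l / r ^ 2) - angle_limit r s).
    { apply b; [|unfold l'; lra].
      apply Rabs_def1; unfold minus, plus, opp; simpl; unfold l'; lra. }
    apply Rabs_def2 in b'.
    assert (progression_angle r C1 (l / r ^ 2) < progression_angle r C1 (l' / r ^ 2)); [|lra].
    apply progression_angle_decr; auto; [unfold l' in *; lra|lra|].
    apply Rmult_lt_reg_l with (r ^ 2); auto. unfold l' in *. lra.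
Qed.

Theorem proposition5p10 (r : R) (hr : 0 < r) :
  (* the progression angle is well defined for lambda = r^2 C2 > D *)
  (forall C1 C2 : R, D_bound r C1 < r ^ 2 * C2 ->
     0 < root_A2 r C1 C2 < root_A1 r C1 C2 /\
     cubic r C1 C2 (root_A1 r C1 C2) = 0 /\
     cubic r C1 C2 (root_A2 r C1 C2) = 0 /\
     ex_RInt_gen (angle_integrand r C1 C2)
       (at_right (root_A2 r C1 C2)) (at_left (root_A1 r C1 C2))) /\
  (* L C1 is the limit of the progression angle as lambda tends to D from above *)
  exists L : R -> R,
    (forall C1 : R,
       filterlim (fun lambda : R => progression_angle r C1 (lambda / r ^ 2))
         (at_right (D_bound r C1)) (locally (L C1))) /\
    (* (1) *)
    L 0 = sqrt 2 * PI /\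
    (* (2) *)
    ((forall C1 C1' : R, C1 < C1' -> L C1 < L C1') /\
     is_lim L m_infty PI /\
     is_lim L p_infty (2 * PI)) /\
    (* (3) *)
    (forall C1 : R,
       (forall C2 C2' : R, D_bound r C1 < r ^ 2 * C2 -> D_bound r C1 < r ^ 2 * C2' ->
          C2 < C2' -> progression_angle r C1 C2' < progression_angle r C1 C2) /\
       (forall C2 : R, D_bound r C1 < r ^ 2 * C2 ->
          PI < progression_angle r C1 C2 < L C1)) /\
    (* (4) *)
    (forall C1 C2 : R, D_bound r C1 < r ^ 2 * C2 ->
       PI < progression_angle r C1 C2 < 2 * PI).
Proof.
assert (hr2 : 0 < r ^ 2) by nra. assert (hpi := PI_RGT_0).
split.
{ intros C1 C2 h. destruct (critical_parameter r (r ^ 2 * C1) hr) as (s & hs & e).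
  destruct (angle_above_bound r C1 s hr hs e C2 h) as (a & ha & had & ea).
  exact (proj1 (progression_angle_param r C1 _ a hr had ea)). }
set (crit C1 := proj1_sig (critical_parameter r (r ^ 2 * C1) hr)).
assert (hs : forall C1, 0 < crit C1)
  by (intros C1; exact (proj1 (proj2_sig (critical_parameter r (r ^ 2 * C1) hr)))).
assert (hc : forall C1, r ^ 2 * C1 = 4 * r / crit C1 - crit C1 ^ 2)
  by (intros C1; exact (proj2 (proj2_sig (critical_parameter r (r ^ 2 * C1) hr)))).
clearbody crit.
exists (fun C1 => angle_limit r (crit C1)). split; [|split; [|split; [|split]]].
- intros C1. now apply filterlim_progression_angle.
- specialize (hs 0). specialize (hc 0). rewrite Rmult_0_r in hc.
  (* For mu = 0 the critical equation gives s^3 = 4 r, and the ratio under the root is 12 r / (6 r)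
     = 2. *)
  assert (e : crit 0 ^ 3 = 4 * r).
  { assert (e := Rmult_eq_compat_l (crit 0) _ _ hc). rewrite Rmult_0_r in e.
    replace (crit 0 * (4 * r / crit 0 - crit 0 ^ 2)) with (4 * r - crit 0 ^ 3) in e by (field; lra).
    lra. }
  unfold angle_limit. rewrite e, Rmult_comm. do 2 f_equal. field. lra.
- split; [|split].
  + intros C1 C1' h. apply angle_limit_decr; auto. apply (critical_decr r); auto.
    rewrite <- !hc. now apply Rmult_lt_compat_l.
  + apply is_lim_spec. intros eps. assert (heps := cond_pos eps).
    (* From mu < -X follow s^2 > X, then s > 1 and s^3 > X, which makes the error 3 pi r / s^3
       smaller than eps. *)
    set (X := 1 + PI * (3 * r) / eps).
    assert (hX : 0 < PI * (3 * r) / eps)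
      by (apply Rdiv_lt_0_compat; auto; apply Rmult_lt_0_compat; lra).
    exists (- (X / r ^ 2)). intros C1 h.
    specialize (hs C1). specialize (hc C1). set (s := crit C1) in *.
    assert (hmu : r ^ 2 * C1 < - X).
    { replace (- X) with (r ^ 2 * - (X / r ^ 2)) by (field; lra). now apply Rmult_lt_compat_l. }
    assert (0 < 4 * r / s) by (apply Rdiv_lt_0_compat; lra).
    assert (hs2 : X < s ^ 2) by lra.
    assert (hs1 : 1 < s) by (unfold X in hs2; nra).
    assert (hs3 : X < s ^ 3).
    { assert (s ^ 2 * 1 < s ^ 2 * s) by (apply Rmult_lt_compat_l; [apply pow_lt|]; lra). lra. }
    assert (u := angle_limit_ub r s hr hs). assert (l := angle_limit_gt_PI r s hr hs).
    assert (PI * (3 * r / s ^ 3) < eps).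
    { apply Rmult_lt_reg_r with (s ^ 3 / eps); [apply Rdiv_lt_0_compat; unfold X in *; lra|].
      replace (PI * (3 * r / s ^ 3) * (s ^ 3 / eps)) with (PI * (3 * r) / eps)
        by (field; unfold X in *; split; lra).
      replace (eps * (s ^ 3 / eps)) with (s ^ 3) by (field; lra). unfold X in hs3. lra. }
    apply Rabs_def1; lra.
  + apply is_lim_spec. intros eps. assert (heps := cond_pos eps).
    (* From mu > X follows X s < 4 r. The summand 4 r forces s < 1, hence s^3 <= s, and the other
       summand brings the error below eps. *)
    set (X := 4 * r + 6 * PI / eps).
    assert (hX : 0 < 6 * PI / eps) by (apply Rdiv_lt_0_compat; lra).
    exists (X / r ^ 2). intros C1 h.
    specialize (hs C1). specialize (hc C1). set (s := crit C1) in *.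
    assert (hmu : X < r ^ 2 * C1).
    { replace X with (r ^ 2 * (X / r ^ 2)) by (field; lra). now apply Rmult_lt_compat_l. }
    assert (hs2 := pow2_ge_0 s).
    assert (hsX : X * s < 4 * r).
    { replace (4 * r) with (4 * r / s * s) by (field; lra). apply Rmult_lt_compat_r; lra. }
    assert (hs1 : s < 1).
    { apply Rnot_le_lt. intros n. assert (X * 1 <= X * s) by (apply Rmult_le_compat_l; unfold X; lra).
      unfold X in *. lra. }
    assert (hs3 : s ^ 3 <= s).
    { assert (s ^ 2 <= 1 ^ 2) by (apply pow_incr; lra).
      assert (s ^ 2 * s <= 1 * s) by (apply Rmult_le_compat_r; lra). lra. }
    assert (l := angle_limit_lb r s hr hs). assert (u := angle_limit_lt_2PI r s hr hs).
    assert (PI * (3 * s ^ 3 / (2 * r)) < eps).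
    { apply Rmult_lt_reg_r with (4 * r / eps); [apply Rdiv_lt_0_compat; lra|].
      replace (PI * (3 * s ^ 3 / (2 * r)) * (4 * r / eps)) with (6 * PI / eps * s ^ 3) by (field; lra).
      replace (eps * (4 * r / eps)) with (4 * r) by (field; lra).
      apply Rle_lt_trans with (2 := hsX). apply Rle_trans with (6 * PI / eps * s).
      - apply Rmult_le_compat_l; lra.
      - apply Rmult_le_compat_r; [lra|]. unfold X. lra. }
    apply Rabs_def1; lra.
- intros C1. split.
  + intros C2 C2'. now apply progression_angle_decr.
  + intros C2 h. now apply progression_angle_bounds.
- intros C1 C2 h. assert (b := progression_angle_bounds r C1 C2 _ hr (hs C1) (hc C1) h).
  assert (u := angle_limit_lt_2PI r _ hr (hs C1)). lra.
Qed.
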